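(* Let the graph $(\mathsf L,\mathsf E)$, the standard Borel space $\Xi$, the function $h$ and the matrices $\kappa$ and $c$ be as in the context, and let $$K_* = \max\left\{\frac{4 \Delta^{\chi+1}}{\bar{c}(1 - \bar{\kappa})}\,;\ \frac{2 \Delta^{\chi+1} \left(2 \Delta^{\chi-1} +1-\bar{c} \Delta^\chi\right)}{(1-\bar{\kappa})^2\left( 1- \bar{c} \Delta^\chi\right)}\right\},\qquad A=\frac{2\Delta^{\chi+1}}{1-\bar\kappa}.$$ For $K>K_*$, take $\pi\in\Pi(h,K,\kappa,c)$ and $\mu_1,\mu_2\in\mathcal M(\pi,h)$. Then for each $\nu_0\in\mathcal C(\mu_1,\mu_2)$ there exists $\nu\in\mathcal C(\mu_1,\mu_2)$ for which the following estimates hold: $$\gamma(\nu)\le\left[\bar\kappa+AK^{-1}\right]\gamma(\nu_0)+2AK^{-1}\lambda(\nu_0),$$ $$\lambda(\nu)\le\Delta^{\chi-1}\gamma(\nu_0)+\bar c\,\Delta^\chi\lambda(\nu_0).$$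
   Context: Graph: $(\mathsf L,\mathsf E)$ is a countable simple connected graph; $\partial\ell$ is the set of vertices adjacent to $\ell$, $\Delta:=\sup_{\ell}|\partial\ell|<\infty$, and $\chi$ is the chromatic number of the graph. It is a standing fact/assumption that $\chi\le\Delta$ (in particular $\Delta\ge 2$). Spins: $(\Xi,\mathcal B(\Xi))$ is a standard Borel space, $\Xi_\ell$ ($\ell\in\mathsf L$) are copies of $\Xi$, and $X=\Xi^{\mathsf L}$ carries the product $\sigma$-field $\mathcal B(X)$. $\mathcal P(E)$ denotes the set of probability measures on a measurable space $E$. $\mathcal F_\ell$ is the $\sigma$-field $\mathcal B(\Xi^{\mathsf L\setminus\{\ell\}})$, viewed as the sub-$\sigma$-field of $\mathcal B(X)$ generated by the coordinates $x_{\ell'}$, $\ell'\ne\ell$. For $\sigma,\varsigma\in\mathcal P(\Xi)$, $d(\sigma,\varsigma)=\sup_{A\in\mathcal B(\Xi)}|\sigma(A)-\varsigma(A)|$. For $\xi,\eta\in\Xi$, $\upsilon(\xi,\eta)=0$ if $\xi=\eta$ and $1$ otherwise. $\mathcal C(\mu_1,\mu_2)$ is the set of couplings of $\mu_1,\mu_2$ (probability measures on $X^2$ with marginals $\mu_1$ and $\mu_2$). One-site specification: a family $\pi=\{\pi_\ell\}_{\ell\in\mathsf L}$, $\pi_\ell=\{\pi_\ell^x:x\in X\}\subset\mathcal P(\Xi_\ell)$, such that $x\mapsto\pi_\ell^x(B)$ is $\mathcal F_\ell$-measurable for each $B\in\mathcal B(\Xi_\ell)$. Moreover $\pi_\ell^x$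 depends on $x$ only through $(x_{\ell'})_{\ell'\in\partial\ell}$. A measure $\mu\in\mathcal P(X)$ is consistent with $\pi$ if for every $\ell\in\mathsf L$ the conditional distribution of $x_\ell$ under $\mu$ given $\mathcal F_\ell$ is $\pi_\ell^x$ for $\mu$-almost all $x$; equivalently, $\mu(B)=\int_X\int_\Xi \mathbb I_B(\xi\times y_{\{\ell\}^c})\,\pi_\ell^y(d\xi)\,\mu(dy)$ for all $\ell$ and $B\in\mathcal B(X)$, where $\xi\times y_{\{\ell\}^c}$ is the configuration equal to $\xi$ at $\ell$ and to $y$ elsewhere. $\mathcal M(\pi)$ is the set of all such $\mu$. Fixed data: a measurable function $h:\Xi\to[0,+\infty)$; a matrix $\kappa=(\kappa_{\ell\ell'})$ with $\kappa_{\ell\ell'}\ge0$ and $\bar\kappa:=\sup_\ell\sum_{\ell'\in\partial\ell}\kappa_{\ell\ell'}<1$; a matrix $c=(c_{\ell\ell'})$ with $c_{\ell\ell'}\ge 0$ and $0<\bar c:=\sup_\ell\sum_{\ell'\in\partial\ell}c_{\ell\ell'}<1/\Delta^\chi$. The class $\Pi(h,K,\kappa,c)$, $K>0$: the set of one-site specifications $\pi$ such that for each $\ell\in\mathsf L$: (i) $d(\pi_\ell^x,\pi_\ell^y)\le\sum_{\ell'\in\partial\ell}\kappa_{\ell\ell'}\upsilon(x_{\ell'},y_{\ell'})$ for all $x,y\in X_\ell(h,K):=\{x\in X: h(x_{\ell'})\le K\ \text{for all}\ \ell'\in\partial\ell\}$; (ii) $\pi_\ell^x(h):=\int_\Xi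 h\,d\pi_\ell^x\le 1+\sum_{\ell'\in\partial\ell}c_{\ell\ell'}h(x_{\ell'})$ for all $x\in X$. $\mathcal M(\pi,h)$ is the set of $\mu\in\mathcal M(\pi)$ with $\sup_{\ell\in\mathsf L}\int_X h(x_\ell)\,\mu(dx)<\infty$. For $(x^1,x^2)\in X^2$ set $I_\ell(x^1,x^2)=\upsilon(x^1_\ell,x^2_\ell)$ and $H^i_\ell(x^1,x^2)=h(x^i_\ell)$, $i=1,2$. For $\nu\in\mathcal C(\mu_1,\mu_2)$, $\nu(f)=\int f\,d\nu$ and $$\gamma(\nu)=\sup_{\ell\in\mathsf L}\nu(I_\ell),\qquad \lambda(\nu)=\max_{i=1,2}\sup_{\ell,\ell'\in\mathsf L}\nu(I_\ell H^i_{\ell'}).$$ *)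

(* Defs.v *)
From HB Require Import structures.
From mathcomp Require Import all_boot all_order all_algebra.
From mathcomp Require Import all_classical all_reals all_analysis.
From mathcomp Require Import measurable_realfun.
Set Implicit Arguments.
Unset Strict Implicit.
Unset Printing Implicit Defensive.
Import Order.TTheory GRing.Theory Num.Theory.
Import numFieldNormedType.Exports.
Local Open Scope classical_set_scope.
Local Open Scope ring_scope.

Section Graph.
Context {L : countType} (e : rel L).

Definition simple_graph : Prop := symmetric e /\ irreflexive e.

Definition connected_graph : Prop :=
  (exists l : L, True) /\
  forall l l' : L, exists p : seq L, path e l p /\ last l p = l'.

Definition nbr (l : L) : set L := [set l' | e l l'].

Definition colorable (k : nat) : Prop :=
  exists col : L -> 'I_k, forall l l', e l l' -> col l != col l'.

Definition is_chromatic_number (chi : nat) : Prop :=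
  colorable chi /\ forall k, colorable k -> (chi <= k)%N.

(* [counting] is +oo on infinite sets, so a finite value makes every
   neighbourhood finite. *)
Definition max_degree (R : realType) : \bar R :=
  ereal_sup (range (fun l => counting (nbr l))).

(* The inner sum is a finitely supported sum, with value 0 when the support is
   infinite; it is only meaningful when every [nbr l] is finite. *)
Definition row_sup {R : realType} (m : L -> L -> R) : \bar R :=
  ereal_sup (range (fun l => (\sum_(l' \in nbr l) m l l')%:E)).

End Graph.

(* Xi is isomorphic, as a measurable space, to a Polish space with its Borel
   sigma-field. *)
Definition standard_borel (R : realType) d (Xi : measurableType d) : Prop :=
  exists P : completePseudoMetricType R,
    [/\ hausdorff_space P, @second_countable P &
      exists f : Xi -> P, bijective f /\
        (forall A : set P, <<s [set U : set P | open U] >> A <->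
                           measurable (f @^-1` A))].

Section Configurations.
Context (L : countType) d (Xi : measurableType d).

(* Generators of the sigma-field of the coordinates with index in J. *)
Definition coord_sets (J : set L) : set (set (L -> Xi)) :=
  \bigcup_(l in J) preimage_set_system setT (fun x : L -> Xi => x l) measurable.

Definition config := g_sigma_algebraType (coord_sets setT).

(* The same configurations, with the coarser sigma-field generated by the
   coordinates other than l. *)
Definition config_off (l : L) :=
  g_sigma_algebraType (coord_sets [set l' | l' != l]).

End Configurations.
Arguments config : clear implicits.
Arguments config L {d} Xi.
Arguments config_off {L d} Xi l.

Section Specifications.
Context {R : realType} {L : countType} {d : measure_display}
  {Xi : measurableType d}.
Local Notation X := (config L Xi).

Definition replace_at (l : L) (xi : Xi) (y : X) : X :=
  fun l' => if l' == l then xi else y l'.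

Definition tv_dist (s t : probability Xi R) : \bar R :=
  ereal_sup [set `|s A - t A|%E | A in measurable].

Definition upsilon (xi eta : Xi) : R := if xi == eta then 0 else 1.

Definition one_site_family := L -> X -> probability Xi R.

Definition is_specification (e : rel L) (pi : one_site_family) : Prop :=
  (forall l (B : set Xi), measurable B ->
     measurable_fun setT (fun x : config_off Xi l => pi l x B)) /\
  (forall l (x y : X), (forall l', nbr e l l' -> x l' = y l') ->
     forall B, measurable B -> pi l x B = pi l y B).

Definition consistent (pi : one_site_family) (mu : probability X R) : Prop :=
  forall l (B : set X), measurable B ->
    mu B = (\int[mu]_y \int[pi l y]_xi (\1_B (replace_at l xi y))%:E)%E.

Definition in_Pi (e : rel L) (h : Xi -> R) (K : R) (kappa c : L -> L -> R)
    (pi : one_site_family) : Prop :=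
  [/\ is_specification e pi,
      (forall l (x y : X),
         (forall l', nbr e l l' -> h (x l') <= K) ->
         (forall l', nbr e l l' -> h (y l') <= K) ->
         (tv_dist (pi l x) (pi l y) <=
          (\sum_(l' \in nbr e l) kappa l l' * upsilon (x l') (y l'))%:E)%E) &
      (forall l (x : X),
         (\int[pi l x]_xi (h xi)%:E <=
          (1 + \sum_(l' \in nbr e l) c l l' * h (x l'))%:E)%E)].

Definition in_M (pi : one_site_family) (h : Xi -> R) (mu : probability X R) :
    Prop :=
  consistent pi mu /\
  (ereal_sup (range (fun l : L => \int[mu]_x (h (x l))%:E)) < +oo)%E.

Definition coupling (mu1 mu2 : probability X R) (nu : probability (X * X)%type R) :
    Prop :=
  forall B : set X, measurable B ->
    nu (fst @^-1` B) = mu1 B /\ nu (snd @^-1` B) = mu2 B.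

Definition disagree (l : L) (z : X * X) : R := upsilon (z.1 l) (z.2 l).

Definition gamma (nu : probability (X * X)%type R) : \bar R :=
  ereal_sup (range (fun l : L => \int[nu]_z (disagree l z)%:E)%E).

Definition lambda (h : Xi -> R) (nu : probability (X * X)%type R) : \bar R :=
  maxe
    (ereal_sup [set (\int[nu]_z (disagree l z * h (z.1 l'))%:E)%E
               | l in [set: L] & l' in [set: L]])
    (ereal_sup [set (\int[nu]_z (disagree l z * h (z.2 l'))%:E)%E
               | l in [set: L] & l' in [set: L]]).

End Specifications.

Section Constants.
Context {R : realType} (Delta chi : nat) (kbar cbar : R).

Definition K_star : R :=
  Num.max
    (4 * Delta%:R ^+ chi.+1 / (cbar * (1 - kbar)))
    (2 * Delta%:R ^+ chi.+1
       * (2 * Delta%:R ^+ chi.-1 + 1 - cbar * Delta%:R ^+ chi)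
     / ((1 - kbar) ^+ 2 * (1 - cbar * Delta%:R ^+ chi))).

Definition A_const : R := 2 * Delta%:R ^+ chi.+1 / (1 - kbar).

End Constants.

(* Main.v *)
Require Import Defs.
From HB Require Import structures.
From mathcomp Require Import all_boot all_order all_algebra.
From mathcomp Require Import all_classical all_reals all_analysis.
From mathcomp Require Import measurable_realfun.
From mathcomp Require Import ring lra zify.
Set Implicit Arguments.
Unset Strict Implicit.
Unset Printing Implicit Defensive.
Import Order.TTheory GRing.Theory Num.Theory.
Import numFieldNormedType.Exports.
Local Open Scope classical_set_scope.
Local Open Scope ring_scope.

(** It suffices to prove uniqueness: if [mu1] and [mu2] agree, the diagonal
    coupling satisfies both estimates since [gamma] and [lambda] vanish on it.
    Uniqueness is proved by updating couplings one site at a time: the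
    pair of spins at [l] is redrawn from a maximal coupling of the two one-site
    laws, chosen measurably in the pair of configurations; by consistency this
    preserves the marginals.

    Let u(a) be the probability of a disagreement at a and w(a,b) the integral of
    a disagreement at a times [h] at b.  Updating the sites of a finite set colour
    by colour, a disagreement at a site of colour k (from 0) is inherited from the
    neighbours at cost Delta^(k+1), while redrawing the spin at b replaces w(a,b)
    by u(a) plus cbar times older values of w(a,.).  Since cbar Delta^chi < 1, a
    full sweep multiplies all bounds by some r < 1, provided K is large.  Only
    finitely many updates are needed to control a given finite set of sites, so
    no infinite-volume update has to be constructed. *)

(** * Countable separating algebras *)

(** The contraction by [kappa] is available only when [h] is at most [K] around the site. Elsewhere
    the total variation distance is merely bounded by 1, and a Markov-type estimate turns this into
    terms w(a,b) / K, so u cannot be controlled without w. The two are measured on different scales,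
    u against s and w against s * lam, where lam solves D^chi * (1 + cbar * lam) = r * lam. The
    colour order is what bounds by chi the length of a chain of inherited disagreements within a
    sweep; this is where the power D^chi comes from.

    Bounds on sweeps read: for every finite set of sites there is a coupling such that the bound
    holds there. An update at l reads the neighbours of l, so each colour consumes the previous
    bound on a larger finite set. This form suffices because a measure on configurations is
    determined by its values on finite cylinders.

    The standard Borel assumption enters through a countable algebra of sets: that it generates
    makes the maximal coupling measurable in the pair of configurations, and that it separates
    points makes disagreement a measurable event. *)

Definition countable_separating_algebra d (T : measurableType d)
    (A : nat -> set T) : Prop :=
  [/\ (forall n, measurable (A n)),
      (forall n, exists m, A m = ~` A n),
      (forall n m, exists k, A k = A n `|` A m),
      measurable `<=` <<s range A>> &
      forall x y, x != y -> exists n, A n x /\ ~ A n y].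

Section GeneratedAlgebra.
Context (T : Type) (U : nat -> set T).

(* A formula over [U]: inner nodes are finite unions, complemented when the label
   is 0. *)
Fixpoint interp (t : GenTree.tree nat) : set T :=
  match t with
  | GenTree.Leaf n => U n
  | GenTree.Node n ts =>
      let V := foldr (fun t s => interp t `|` s) set0 ts in
      if n is 0%N then ~` V else V
  end.

Definition algebra_seq (n : nat) : set T :=
  if unpickle n is Some t then interp t else set0.

Lemma algebra_seq_pickle t : algebra_seq (pickle t) = interp t.
Proof. by rewrite /algebra_seq pickleK. Qed.

Lemma algebra_seqP n : exists t, algebra_seq n = interp t.
Proof.
rewrite /algebra_seq; case: unpickle => [t|]; first by exists t.
by exists (GenTree.Node 1 [::]).
Qed.

Lemma algebra_seq_gen n : exists m, algebra_seq m = U n.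
Proof. by exists (pickle (GenTree.Leaf n)); rewrite algebra_seq_pickle. Qed.

Lemma algebra_seqC n : exists m, algebra_seq m = ~` algebra_seq n.
Proof.
have [t ->] := algebra_seqP n; exists (pickle (GenTree.Node 0 [:: t])).
by rewrite algebra_seq_pickle /= setU0.
Qed.

Lemma algebra_seqU n m : exists k, algebra_seq k = algebra_seq n `|` algebra_seq m.
Proof.
have [t ->] := algebra_seqP n; have [s ->] := algebra_seqP m.
exists (pickle (GenTree.Node 1 [:: t; s])).
by rewrite algebra_seq_pickle /= setU0.
Qed.

End GeneratedAlgebra.

Lemma measurable_algebra_seq d (T : measurableType d) (U : nat -> set T) :
  (forall n, measurable (U n)) -> forall n, measurable (algebra_seq U n).
Proof.
move=> mU n; have [t ->] := algebra_seqP U n.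
(* Trees nest through lists, so recursion on the tree is combined with an inner induction on the
   list of children. *)
move: t; fix IH 1 => -[k|k ts] /=; first exact: mU.
suff mV : measurable (foldr (fun t s => interp U t `|` s) set0 ts).
  by case: k => //; exact: measurableC.
elim: ts => [|t ts IHts] /=; first exact: measurable0.
by apply: measurableU => //; exact: IH.
Qed.

Lemma second_countable_seq (P : topologicalType) : @second_countable P ->
  exists U : nat -> set P, (forall n, open (U n)) /\
    forall x V, nbhs x V -> exists n, U n x /\ U n `<=` V.
Proof.
move=> [B /countable_injP[f finj] [Bo Bb]].
(* The injection [f] numbers the base: the union at [n] has at most one member and is empty when [n]
   codes no base set. *)
exists (fun n => \bigcup_(V in [set V | B V /\ f V = n]) V); split.
  by move=> n; apply: bigcup_open => V [/Bo].
move=> x V /Bb[W [BW Wx] WV]; exists (f W).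
suff -> : \bigcup_(V0 in [set V0 | B V0 /\ f V0 = f W]) V0 = W by [].
apply/seteqP; split=> [y [W' [BW' /finj WW'] W'y]|y Wy]; last by exists W.
by rewrite -WW' ?inE.
Qed.

Lemma standard_borel_countable_algebra (R : realType) d (Xi : measurableType d) :
  standard_borel R Xi -> exists A : nat -> set Xi, countable_separating_algebra A.
Proof.
move=> [P [hP /second_countable_seq[U [Uo Ub]] [f [[g fK gK] fm]]]].
have mfU n : measurable (f @^-1` U n).
  by apply/fm; apply: sub_sigma_algebra; exact: Uo.
exists (algebra_seq (fun n => f @^-1` U n)); split.
- exact: measurable_algebra_seq.
- exact: algebra_seqC.
- exact: algebra_seqU.
- move=> B mB.
  have /fm : measurable (f @^-1` (g @^-1` B)).
    rewrite (_ : _ @^-1` _ = B)//; apply/funext => x /=.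
    by rewrite /preimage /= fK.
  (* The sets whose preimage lies in the generated sigma-field form a sigma-field, and every open
     set is a countable union of base sets. *)
  suff H : <<s [set U : set P | open U] >> `<=`
      [set V | <<s range (algebra_seq (fun n => f @^-1` U n)) >> (f @^-1` V)].
    move=> /H /=; rewrite (_ : _ @^-1` _ = B)//; apply/funext => x /=.
    by rewrite /preimage /= fK.
  apply: smallest_sub.
    split => /=.
    + by rewrite preimage_set0; exact: sigma_algebra0.
    + move=> V /sigma_algebraCD; rewrite !setTD; exact.
    + move=> F FV; rewrite preimage_bigcup; exact: sigma_algebra_bigcup.
  move=> V /= oV.
  have -> : V = \bigcup_(n in [set n | U n `<=` V]) U n.
    apply/seteqP; split=> [x Vx|x [n nV] Unx]; last exact: nV.
    have [n [Unx UV]] := Ub x V (open_nbhs_nbhs (conj oV Vx)).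
    by exists n.
  rewrite preimage_bigcup bigcup_mkcond; apply: sigma_algebra_bigcup => n.
  case: ifPn => _; last exact: sigma_algebra0.
  by apply: sub_sigma_algebra; have [m <-] := algebra_seq_gen (fun n => f @^-1` U n) n; exists m.
- move=> x y xy.
  have fxy : f x != f y by apply: contra_neq xy => /(congr1 g); rewrite !fK.
  move: hP; rewrite open_hausdorff => /(_ _ _ fxy)[[V W] /= [Vx Wy] [oV oW /eqP VW]].
  have [n [Unx UV]] := Ub (f x) V (open_nbhs_nbhs (conj oV (set_mem Vx))).
  have [m Am] := algebra_seq_gen (fun n => f @^-1` U n) n.
  exists m; rewrite Am; split => //= /UV Vy.
  have : (V `&` W) (f y) by split => //; exact: set_mem.
  by rewrite VW.
Qed.

(** * Approximation in measure by a countable algebra *)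

Definition set_diff_sym T (A B : set T) : set T := (A `\` B) `|` (B `\` A).

Section Approximation.
Context d (T : measurableType d) (R : realType) (mu : {finite_measure set T -> \bar R}).
Variables (A : nat -> set T) (mA : forall n, measurable (A n)).
Hypothesis AC : forall n, exists m, A m = ~` A n.
Hypothesis AU : forall n m, exists k, A k = A n `|` A m.

Definition approximable (P : set T) : Prop :=
  measurable P /\
  forall r : R, 0 < r -> exists n, (mu (set_diff_sym (A n) P) < r%:E)%E.

Lemma measurable_set_diff_sym (P Q : set T) :
  measurable P -> measurable Q -> measurable (set_diff_sym P Q).
Proof. by move=> mP mQ; apply: measurableU; exact: measurableD. Qed.

Lemma approximable_seq n : approximable (A n).
Proof.
split=> // r r0; exists n.
by rewrite /set_diff_sym setDv setU0 measure0 lte_fin.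
Qed.

Lemma approximableC P : approximable P -> approximable (~` P).
Proof.
move=> [mP aP]; split; first exact: measurableC.
move=> r /aP[n nP]; have [m mn] := AC n; exists m.
by rewrite mn /set_diff_sym !setDE !setCK setIC (setIC _ (A n)) -!setDE setUC.
Qed.

Lemma approximableU P Q : approximable P -> approximable Q ->
  approximable (P `|` Q).
Proof.
move=> [mP aP] [mQ aQ]; split; first exact: measurableU.
move=> r r0; have r20 : 0 < r / 2 by rewrite divr_gt0.
have [[n nP] [m mQm]] := (aP _ r20, aQ _ r20); have [k kE] := AU n m.
exists k; rewrite kE.
apply: (@le_lt_trans _ _
    (mu (set_diff_sym (A n) P `|` set_diff_sym (A m) Q))).
  apply: le_measure; rewrite ?inE.
  - apply: measurable_set_diff_sym; exact: measurableU.
  - by apply: measurableU; exact: measurable_set_diff_sym.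
  - move=> x; rewrite /set_diff_sym /= !not_orE; tauto.
apply: le_lt_trans (measureU2 _ _ _) _; try exact: measurable_set_diff_sym.
by rewrite [ltRHS](_ : _ = (r / 2)%:E + (r / 2)%:E)%E ?lteD// -EFinD -splitr.
Qed.

(** Continuity from below makes some [F N] exhaust the union up to r/2; the other r/2 is spent on
    approximating that [F N]. *)
Lemma approximable_ndseq (F : nat -> set T) : nondecreasing_seq F ->
  (forall n, approximable (F n)) -> approximable (\bigcup_n F n).
Proof.
move=> ndF aF; have mF n : measurable (F n) by have [] := aF n.
have mUF : measurable (\bigcup_n F n) by exact: bigcupT_measurable.
split=> // r r0; have r20 : 0 < r / 2 by rewrite divr_gt0.
have muF := nondecreasing_cvg_mu (mu := mu) mF mUF ndF.
have : \forall n \near \oo, (mu (\bigcup_n F n) - (r / 2)%:E < mu (F n))%E.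
  have lt : (mu (\bigcup_n F n) - (r / 2)%:E < mu (\bigcup_n F n))%E.
    by rewrite lteBlDr ?fin_num_measure// lteDl ?fin_num_measure// lte_fin.
  exact: (muF [set y | (mu (\bigcup_n F n) - (r / 2)%:E < y)%E]
    (open_ereal_gt' lt)).
move=> [N _ /(_ N (leqnn N)) muFN].
have muUFN : (mu (\bigcup_n F n `\` F N) < (r / 2)%:E)%E.
  rewrite measureD ?fin_num_measure ?ltey_eq ?fin_num_measure//.
  rewrite setIidr; last exact: bigcup_sup.
  by rewrite lteBlDr ?fin_num_measure// addeC -lteBlDr ?fin_num_measure.
have [_ /(_ _ r20)[n nFN]] := aF N; exists n.
apply: (@le_lt_trans _ _
    (mu (set_diff_sym (A n) (F N) `|` (\bigcup_n F n `\` F N)))).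
  apply: le_measure; rewrite ?inE.
  - exact: measurable_set_diff_sym.
  - by apply: measurableU; [exact: measurable_set_diff_sym|exact: measurableD].
  - have FNU x : F N x -> (\bigcup_n F n) x by move=> FNx; exists N.
    move=> x [[Anx nU]|[Ux nA]]; first by left; left; split => // /FNU.
    by have [FNx|nFNx] := pselect (F N x); [left; right|right].
apply: le_lt_trans (measureU2 _ _ _) _.
- exact: measurable_set_diff_sym.
- exact: measurableD.
by rewrite [ltRHS](_ : _ = (r / 2)%:E + (r / 2)%:E)%E ?lteD// -EFinD -splitr.
Qed.

Lemma generated_approximable (P : set T) : <<s range A>> P -> approximable P.
Proof.
move: P; apply: smallest_sub; last by move=> _ [n _ <-]; exact: approximable_seq.
(* The empty set is the complement of the union of [A 0] and its complement. *)
have a0 : approximable set0.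
  rewrite -(setICr (A 0)) -(setCK (_ `&` _)) setCI setCK.
  apply/approximableC/approximableU; last exact: approximable_seq.
  by apply: approximableC; exact: approximable_seq.
split=> [//|P|F aF]; first by rewrite setTD; exact: approximableC.
rewrite -bigcup_bigsetU_bigcup; apply: approximable_ndseq => [|n].
  apply/nondecreasing_seqP => n; apply/subsetPset.
  by rewrite [X in _ `<=` X]big_ord_recr /=; exact: subsetUl.
by elim/big_ind : _ => //; exact: approximableU.
Qed.

End Approximation.

(** * Maximal couplings *)

Section ProbabilityOfMeasure.
Context d (T : measurableType d) (R : realType).
Variables (m : {measure set T -> \bar R}) (m1 : m setT = 1%E).

(** The alias is a fresh name to which the probability structure, which depends on the proof [m1],
    can be attached. *)
Definition normalized_measure : set T -> \bar R := m.

HB.instance Definition _ := Measure.on normalized_measure.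
HB.instance Definition _ := Measure_isProbability.Build _ _ _ normalized_measure m1.

Lemma probability_of_measure : exists P : probability T R, forall B, P B = m B.
Proof. by exists normalized_measure. Qed.

End ProbabilityOfMeasure.

(** With [P] a Hahn set of s - t, [m] is the meet of [s] and [t], while [a] and [b] are the positive
    and negative parts of s - t. Hence s = m + a and t = m + b. *)
Lemma excess_decomposition d (T : measurableType d) (R : realType)
    (s t : probability T R) :
  exists (m : {measure set T -> \bar R}) (a b : {finite_measure set T -> \bar R})
      (P : set T),
    [/\ measurable P,
        forall B, measurable B -> m B = (t (B `&` P) + s (B `\` P))%E,
        forall B, measurable B -> a B = (s (B `&` P) - t (B `&` P))%E &
        forall B, measurable B -> b B = (t (B `\` P) - s (B `\` P))%E].
Proof.
pose nu : {charge set T -> \bar R} :=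
  cadd (charge_of_finite_measure s) (cscale (-1) (charge_of_finite_measure t)).
have nuE B : nu B = (s B - t B)%E by rewrite /nu /= /cadd /= /cscale EFinN mulN1e.
have [P [N PN]] := Hahn_decomposition nu.
have [[mP _] [mN _] PNT PN0] := PN.
have NE : N = ~` P.
  apply/seteqP; split=> [x Nx Px|x nPx].
    by have : (P `&` N) x by []; rewrite PN0.
  by have : (P `|` N) x by [rewrite PNT]; case.
pose m1 : {measure set T -> \bar R} := mrestr t mP.
pose m2 : {measure set T -> \bar R} := mrestr s mN.
exists (measure_add m1 m2), (jordan_pos PN), (jordan_neg PN), P.
split=> // B mB.
- by rewrite [LHS]measure_addE /m1 /m2 /= /mrestr NE -setDE.
- by rewrite [LHS]jordan_posE cjordan_posE /crestr0 mem_set// /crestr nuE.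
- rewrite [LHS]jordan_negE cjordan_negE /crestr0 mem_set// /crestr nuE NE -setDE.
  rewrite fin_num_oppeB ?fin_num_measure// 1?addeC//; exact: measurableD.
Qed.

Section ExcessCoupling.
Context d (T : measurableType d) (R : realType).
Variables (m : {measure set T -> \bar R}) (a b : {finite_measure set T -> \bar R}).
Variables (s t : probability T R).
Hypothesis sE : forall B, measurable B -> s B = (m B + a B)%E.
Hypothesis tE : forall B, measurable B -> t B = (m B + b B)%E.

(** The common part [m] is at most [s], hence finite, and can be cancelled from the equality of the
    two total masses. *)
Lemma excess_mass : a setT = b setT.
Proof.
have := sE measurableT; rewrite probability_setT -(@probability_setT _ _ _ t) tE//.
have mfin : m setT \is a fin_num.
  have : (m setT <= 1)%E by rewrite -(@probability_setT _ _ _ s) sE// leeDl.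
  by move=> m1; rewrite ge0_fin_numE// (le_lt_trans m1)// ltry.
by move=> /(congr1 (fun x => x - m setT)%E); rewrite addeAC subee// add0e addeAC subee// add0e.
Qed.

(* The diagonal part carries the common mass [m], the product part the two
   excesses; when the excess vanishes the factor is [0^-1 = 0]. *)
Lemma excess_coupling : exists rho : probability (T * T)%type R,
  forall C, measurable C -> rho C =
    (m [set x | C (x, x)] + ((fine (a setT))^-1)%:E * (a \x b) C)%E.
Proof.
have mdiag : measurable_fun setT (fun x : T => (x, x)) by exact: measurable_fun_pair.
have k0 : 0 <= (fine (a setT))^-1 by rewrite invr_ge0 fine_ge0.
have [m1 m1E] : exists m1 : {measure set (T * T) -> \bar R},
    forall C, m1 C = m [set x | C (x, x)].
  by unshelve eexists (pushforward m (fun x : T => (x, x))).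
pose m2 : {measure set (T * T) -> \bar R} := (a \x b)%E.
pose rho : {measure set (T * T) -> \bar R} :=
  measure_add m1 (mscale (NngNum k0) m2).
have rhoE C : rho C = (m [set x | C (x, x)] + ((fine (a setT))^-1)%:E * m2 C)%E.
  by rewrite -m1E [LHS]measure_addE.
have rhoT : rho setT = 1%E.
  rewrite rhoE /m2 /= -setXTT product_measure1E// -[X in (_ * (_ * X))%E]/(b setT) -excess_mass.
  rewrite -(@probability_setT _ _ _ s) sE//; congr (_ + _)%E.
  have afin : a setT \is a fin_num by rewrite fin_num_measure.
  rewrite -[X in (_ * (X * _))%E]/(a setT).
  case: (a setT) afin => [r _| |]//=; rewrite -!EFinM; congr EFin.
  by have [->|r0] := eqVneq r 0; rewrite ?mulr0// mulKf.
have [rho' rho'E] := probability_of_measure rhoT.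
by exists rho' => C _; rewrite rho'E -rhoE.
Qed.

End ExcessCoupling.

(** * Measures depending measurably on a parameter *)

Section KernelOfFamily.
Context dZ (Z : measurableType dZ) d (T : measurableType d) (R : realType).

Lemma finite_kernel_of_family (a : Z -> {measure set T -> \bar R}) :
  (forall B, measurable B -> measurable_fun setT (a ^~ B)) ->
  (forall z, (a z setT <= 1)%E) ->
  exists k : R.-fker Z ~> T, k = a :> (Z -> {measure set T -> \bar R}).
Proof.
move=> ma a1.
pose K := isKernel.Build dZ d Z T R a ma.
pose k1 : R.-ker Z ~> T := HB.pack_for (R.-ker Z ~> T) a K.
have ub : measure_fam_uub k1.
  (* The uniform bound on a finite kernel has to be strict, hence 2 and not 1. *)
  by exists 2 => z; rewrite (le_lt_trans (a1 z))// lte_fin ltr1n.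
pose F := Kernel_isFinite.Build dZ d Z T R k1 ub.
pose k2 : R.-fker Z ~> T := HB.pack_for (R.-fker Z ~> T) a (Kernel.class k1) F.
by exists k2.
Qed.

End KernelOfFamily.

(** The product measure of [C] is the [a z]-integral of the [b z]-measure of the sections of [C].
    Reading [b] as a kernel from pairs that ignores the second entry makes the inner measure jointly
    measurable, and the outer integral then keeps measurability in [z]. *)
Lemma measurable_product_measure dZ (Z : measurableType dZ) d1 d2
    (T1 : measurableType d1) (T2 : measurableType d2) (R : realType)
    (a : Z -> {finite_measure set T1 -> \bar R})
    (b : Z -> {finite_measure set T2 -> \bar R}) :
  (forall B, measurable B -> measurable_fun setT (fun z => a z B)) ->
  (forall B, measurable B -> measurable_fun setT (fun z => b z B)) ->
  (forall z, (a z setT <= 1)%E) -> (forall z, (b z setT <= 1)%E) ->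
  forall C, measurable C -> measurable_fun setT (fun z => (a z \x b z)%E C).
Proof.
move=> ma mb a1 b1 C mC.
have [ka kaE] := @finite_kernel_of_family _ _ _ _ R (fun z => a z) ma a1.
have [kb kbE] := @finite_kernel_of_family _ (Z * T1)%type _ _ R (fun p => b p.1)
  (fun B mB => measurableT_comp (mb B mB) measurable_fst) (fun p => b1 p.1).
pose C' : set ((Z * T1) * T2) := (fun q => (q.1.2, q.2)) @^-1` C.
have mC' : measurable C'.
  rewrite -[C']setTI; apply: (_ : measurable_fun setT _) => //.
  apply/measurable_fun_pair => /=; first exact: measurableT_comp.
  exact: measurable_snd.
have mk := measurable_fun_xsection_finite_kernel kb (mem_set mC').
have := measurable_fun_integral_finite_kernel
  (fun p => kb p (xsection C' p)) ka (fun=> measure_ge0 _ _) mk.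
apply: eq_measurable_fun => z _; rewrite kaE; apply: eq_integral => x _ /=.
by rewrite kbE /=; congr (b z _); apply/seteqP; split=> y; rewrite /xsection /= !inE.
Qed.

(** [nu'] is the law of g(z, w) when [z] has law [nu] and [w], given [z], has law [rho z]. It is
    built as a composition of kernels, with [nu] viewed as a kernel from the one-point space. *)
Lemma integral_kernel_pushforward dZ (Z : measurableType dZ) dW
    (W : measurableType dW) dV (V : measurableType dV) (R : realType)
    (nu : probability Z R) (rho : Z -> probability W R) (g : Z * W -> V) :
  (forall B, measurable B -> measurable_fun setT (fun z => rho z B)) ->
  measurable_fun setT g ->
  exists nu' : probability V R, forall f : V -> \bar R,
    (forall v, (0 <= f v)%E) -> measurable_fun setT f ->
    measurable_fun setT (fun z => \int[rho z]_w f (g (z, w)))%E /\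
    (\int[nu']_v f v = \int[nu]_z \int[rho z]_w f (g (z, w)))%E.
Proof.
move=> mrho mg.
have mgz z : measurable_fun setT (fun w => g (z, w)).
  by apply: measurableT_comp => //; exact: measurable_pair1.
have [p pE] : exists p : Z -> {measure set V -> \bar R}, forall z B,
    p z B = rho z ((fun w => g (z, w)) @^-1` B).
  by unshelve eexists (fun z => pushforward (rho z) (fun w => g (z, w))).
have [l lE] := @finite_kernel_of_family _ unit _ _ R (fun=> nu)
   (fun B mB => measurable_cst _) (fun=> probability_le1 _ measurableT).
have [kr krE] := @finite_kernel_of_family _ _ _ _ R (fun z => rho z) mrho
  (fun z => probability_le1 _ measurableT).
have mp B : measurable B -> measurable_fun setT (fun q : unit * Z => p q.2 B).
  move=> mB.
  have mgB : measurable (g @^-1` B) by rewrite -[_ @^-1` _]setTI; exact: mg.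
  have mk := measurable_fun_xsection_finite_kernel kr (mem_set mgB).
  have := measurableT_comp mk (measurable_snd : measurable_fun setT (@snd unit Z)).
  apply: eq_measurable_fun => -[u z] _ /=; rewrite krE pE; congr (rho z _).
  by apply/seteqP; split=> w; rewrite /xsection /= inE.
have p1 (q : unit * Z) : (p q.2 setT <= 1)%E by rewrite pE preimage_setT probability_setT.
have [k kE] := @finite_kernel_of_family _ (unit * Z)%type _ _ R (fun q => p q.2) mp p1.
pose nu1 : {measure set V -> \bar R} := (l \; k)%E tt.
have nu1T : nu1 setT = 1%E.
  rewrite /nu1 /mkcomp /= /kcomp lE kE /=.
  under eq_integral do rewrite pE preimage_setT probability_setT.
  by rewrite integral_cst// mul1e; exact: probability_setT.
have [nu' nu'E] := probability_of_measure nu1T.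
exists nu' => f f0 mf; split.
  have := measurable_fun_integral_finite_kernel (f \o g) kr (fun=> f0 _)
    (measurableT_comp mf mg).
  by rewrite krE.
transitivity (\int[nu1]_v f v)%E; first by apply: eq_measure_integral => B _ _; exact: nu'E.
transitivity (\int[l tt]_z \int[k (tt, z)]_v f v)%E; first exact: integral_kcomp.
rewrite lE kE /=.
apply: eq_integral => z _.
rewrite -(@ge0_integral_pushforward _ _ _ _ _ _ (mgz z) (rho z) setT f)//.
by apply: eq_measure_integral => B mB _; rewrite pE.
Qed.

Section MutuallySingular.
Context d (T : measurableType d) (R : realType) (A : nat -> set T).
Hypothesis hA : countable_separating_algebra A.
Variables (a b : {finite_measure set T -> \bar R}) (P : set T).
Hypothesis mP : measurable P.
Hypothesis aP : forall B, measurable B -> B `&` P = set0 -> a B = 0%E.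
Hypothesis bP : forall B, measurable B -> B `<=` P -> b B = 0%E.

(* The Hahn set [P] depends on the pair of measures with no control on
   measurability; restricting the supremum to a countable algebra makes the
   excess measurable in any parameter of the two measures. *)
Lemma positive_part_sup B : measurable B ->
  a B = ereal_sup (range (fun n => (a (B `&` A n) - b (B `&` A n))%E)).
Proof.
move=> mB; have [mA AC AU Agen _] := hA.
have mBA n : measurable (B `&` A n) by exact: measurableI.
apply/eqP; rewrite eq_le; apply/andP; split; last first.
  apply: ge_ereal_sup => _ [n _ <-].
  rewrite leeBlDr ?fin_num_measure//; apply: (@le_trans _ _ (a B)).
    by apply: le_measure; rewrite ?inE//; exact: subIsetl.
  by rewrite leeDl.
(* Approximating [P] for the sum a + b controls both errors by one index [n]. *)
pose mu0 : {measure set T -> \bar R} := measure_add a b.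
have mu0E X : mu0 X = (a X + b X)%E by rewrite [LHS]measure_addE.
have fmu0 : fin_num_fun mu0.
  by move=> X mX; rewrite mu0E fin_numD !fin_num_measure.
pose mu : {finite_measure set T -> \bar R} :=
  HB.pack_for {finite_measure set T -> \bar R} (mu0 : set _ -> _)
    (Measure.class mu0) (Measure_isFinite.Build _ _ _ mu0 fmu0).
apply/lee_addgt0Pr => e e0.
have [_ /(_ _ e0)[n]] := generated_approximable mu mA AC AU (Agen _ mP).
rewrite [X in (X < _)%E](mu0E _) => Pn.
apply: (@le_trans _ _ ((a (B `&` A n) - b (B `&` A n)) + e%:E)%E); last first.
  by rewrite leeD2r//; apply: ereal_sup_ubound; exists n.
have mD : measurable (set_diff_sym (A n) P) by exact: measurable_set_diff_sym.
(* Up to the symmetric difference of [A n] and [P], all of [a] on [B] sits in [A n], and [b] gives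
   no mass to [B] within [A n]. The two errors add up to less than [e]. *)
have aB : (a B <= a (B `&` A n) + a (set_diff_sym (A n) P))%E.
  apply: (@le_trans _ _ (a ((B `&` A n `|` set_diff_sym (A n) P) `|` (B `\` P)))).
    apply: le_measure; rewrite ?inE//.
      by apply: measurableU; [exact: measurableU|exact: measurableD].
    move=> x Bx; rewrite /set_diff_sym /=.
    by have [Ax|nAx] := pselect (A n x); have [Px|nPx] := pselect (P x); tauto.
  apply: le_trans (measureU2 _ _ _) _; [exact: measurableU|exact: measurableD|].
  have aBP : a (B `\` P) = 0%E.
    by apply: aP; [exact: measurableD|rewrite setDE -setIA setICl setI0].
  rewrite [X in (_ + X <= _)%E]aBP adde0; exact: measureU2.
have bB : (b (B `&` A n) <= b (set_diff_sym (A n) P))%E.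
  apply: (@le_trans _ _ (b (set_diff_sym (A n) P `|` (B `&` P)))).
    apply: le_measure; rewrite ?inE//.
      by apply: measurableU => //; exact: measurableI.
    move=> x [Bx Ax]; rewrite /set_diff_sym /=.
    by have [Px|nPx] := pselect (P x); tauto.
  apply: le_trans (measureU2 _ _ _) _ => //; first exact: measurableI.
  have bBP : b (B `&` P) = 0%E.
    by apply: bP; [exact: measurableI|exact: subIsetr].
  by rewrite [X in (_ + X <= _)%E]bBP adde0.
move: aB bB Pn; rewrite -(fineK (fin_num_measure a _ mB)).
rewrite -(fineK (fin_num_measure a _ (mBA n))) -(fineK (fin_num_measure b _ (mBA n))).
rewrite -(fineK (fin_num_measure a _ mD)) -(fineK (fin_num_measure b _ mD)).
rewrite -!EFinD. rewrite !lee_fin !lte_fin; lra.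
Qed.



End MutuallySingular.

Lemma measurable_neq d (T : measurableType d) (A : nat -> set T) :
  countable_separating_algebra A -> measurable [set w : T * T | w.1 != w.2].
Proof.
move=> [mA AC AU Agen Asep].
have -> : [set w : T * T | w.1 != w.2] = \bigcup_n (A n `*` ~` A n).
  apply/seteqP; split=> [[x y] /= /Asep[n [Ax Ay]]|[x y] [n _ [/= Ax Ay]]].
    by exists n.
  by apply/eqP => xy; rewrite xy in Ax.
apply: bigcupT_measurable => n.
by apply: measurableX => //; exact: measurableC.
Qed.

(** The sets [P z] come from choice, so measurability in [z] must not go through them: by
    [positive_part_sup], with a - b = s - t, each [a z B] is a countable supremum of differences of
    [s] and [t] on sets of the algebra. Then b = t + a - s and m = s - a are measurable as well. *)
Lemma measurable_optimal_coupling dZ (Z : measurableType dZ) d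
    (T : measurableType d) (R : realType) (A : nat -> set T)
    (s t : Z -> probability T R) :
  countable_separating_algebra A ->
  (forall B, measurable B -> measurable_fun setT (fun z => s z B)) ->
  (forall B, measurable B -> measurable_fun setT (fun z => t z B)) ->
  exists rho : Z -> probability (T * T)%type R,
    [/\ forall C, measurable C -> measurable_fun setT (fun z => rho z C),
        forall z B, measurable B -> rho z (B `*` setT) = s z B,
        forall z B, measurable B -> rho z (setT `*` B) = t z B &
        forall z, (rho z [set w | w.1 != w.2] <= tv_dist (s z) (t z))%E].
Proof.
move=> hA ms mt; have [mA _ _ _ _] := hA.
have /choice[m /choice[a /choice[b /choice[P dec]]]] z :=
  excess_decomposition (s z) (t z).
have mP z : measurable (P z) by have [] := dec z.
have mE z B : measurable B -> m z B = (t z (B `&` P z) + s z (B `\` P z))%E.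
  by have [_ + _ _] := dec z; apply.
have aE z B : measurable B -> a z B = (s z (B `&` P z) - t z (B `&` P z))%E.
  by have [_ _ + _] := dec z; apply.
have bE z B : measurable B -> b z B = (t z (B `\` P z) - s z (B `\` P z))%E.
  by have [_ _ _ +] := dec z; apply.
have addKe (x y : \bar R) : y \is a fin_num -> (y + (x - y) = x)%E.
  by move=> yfin; rewrite addeCA subee// adde0.
have splitP (r : probability T R) z B : measurable B ->
    r B = (r (B `&` P z) + r (B `\` P z))%E.
  by move=> mB; rewrite addeC -measureDI.
have finM (r : probability T R) B : measurable B -> r B \is a fin_num.
  exact: fin_num_measure.
have mBP z B : measurable B -> measurable (B `&` P z) by move=> mB; exact: measurableI.
have mBD z B : measurable B -> measurable (B `\` P z) by move=> mB; exact: measurableD.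
have finMP (r : probability T R) z B : measurable B -> r (B `&` P z) \is a fin_num.
  by move=> mB; apply: finM; exact: mBP.
have finMD (r : probability T R) z B : measurable B -> r (B `\` P z) \is a fin_num.
  by move=> mB; apply: finM; exact: mBD.
have sE z B : measurable B -> s z B = (m z B + a z B)%E.
  by move=> mB; rewrite mE// aE// addeAC addKe ?finMP// -splitP.
have tE z B : measurable B -> t z B = (m z B + b z B)%E.
  by move=> mB; rewrite mE// bE// -addeA addKe ?finMD// -splitP.
have mfin z B : measurable B -> m z B \is a fin_num.
  by move=> mB; rewrite mE// fin_numD finMP// finMD.
have afin z B : measurable B -> a z B \is a fin_num by exact: fin_num_measure.
have bfin z B : measurable B -> b z B \is a fin_num by exact: fin_num_measure.
have abE z B : measurable B -> (a z B - b z B = s z B - t z B)%E.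
  move=> mB; rewrite sE// tE//; move: (mfin z B mB) (afin z B mB) (bfin z B mB).
  case: (m z B) => // x _; case: (a z B) => // y _; case: (b z B) => // w _.
  by rewrite -!EFinD; congr EFin; ring.
have ma B : measurable B -> measurable_fun setT (fun z => a z B).
  move=> mB.
  have mBA n : measurable (B `&` A n) by exact: measurableI.
  pose f n z := (s z (B `&` A n) - t z (B `&` A n))%E.
  have mf n : measurable_fun setT (f n) by apply: emeasurable_funB; [exact: ms|exact: mt].
  have := measurable_fun_esups mf 0%N; apply: eq_measurable_fun => z _.
  rewrite (@positive_part_sup _ _ _ _ hA (a z) (b z) (P z))//.
  - rewrite /esups /sdrop; congr ereal_sup.
    apply/seteqP; split=> [_ [n _ <-]|_ [n _ <-]]; exists n => //=;
      by rewrite /f abE.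
  - by move=> X mX XP; rewrite aE// XP !measure0 sube0.
  - move=> X mX XP; rewrite bE//; have -> : X `\` P z = set0 by rewrite setD_eq0.
    by rewrite !measure0 sube0.
have mb B : measurable B -> measurable_fun setT (fun z => b z B).
  move=> mB; have := emeasurable_funB (emeasurable_funD (mt B mB) (ma B mB)) (ms B mB).
  apply: eq_measurable_fun => z _ /=; rewrite tE// sE//.
  move: (mfin z B mB) (afin z B mB) (bfin z B mB).
  case: (m z B) => // x _; case: (a z B) => // y _; case: (b z B) => // w _.
  by rewrite -!EFinD; congr EFin; ring.
have mm B : measurable B -> measurable_fun setT (fun z => m z B).
  move=> mB; have := emeasurable_funB (ms B mB) (ma B mB).
  apply: eq_measurable_fun => z _ /=; rewrite sE//.
  move: (mfin z B mB) (afin z B mB).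
  case: (m z B) => // x _; case: (a z B) => // y _.
  by rewrite -!EFinD; congr EFin; ring.
have a1 z : (a z setT <= 1)%E.
  by rewrite -(@probability_setT _ _ _ (s z)) sE// leeDr.
have b1 z : (b z setT <= 1)%E.
  by rewrite -(@probability_setT _ _ _ (t z)) tE// leeDr.
have abT z : a z setT = b z setT by exact: excess_mass (sE z) (tE z).
have /choice[rho rhoE] z := excess_coupling (sE z) (tE z).
have mneq := measurable_neq hA.
(* When the total excess is 0, so is [x], and the default value of the inverse at 0 keeps the
   identity true. *)
have normK z (x : \bar R) : (0 <= x <= a z setT)%E ->
    (((fine (a z setT))^-1)%:E * (x * a z setT) = x)%E.
  move: (afin z _ measurableT); case: (a z setT) => [r _| |]//=; case: x => [x| |]//; last by rewrite leye_eq andbF.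
  rewrite !lee_fin => /andP[x0 xr]; rewrite -!EFinM; congr EFin.
  have [r0|r0] := eqVneq r 0; first by rewrite r0 mulr0 mulr0; lra.
  by rewrite mulrCA mulVf// mulr1.
exists rho; split.
- move=> C mC.
  have mdiag : measurable [set x | C (x, x)].
    have mdg : measurable_fun setT (fun x : T => (x, x)) by exact: measurable_fun_pair.
    by rewrite -[X in measurable X]setTI; exact: (mdg measurableT C mC).
  have mk : measurable_fun setT (fun z => ((fine (a z setT))^-1)%:E).
    apply/measurable_EFinP.
    (* Inversion is read as the power with exponent -1, a measurable function that agrees with it on
       nonnegative reals, 0 included. *)
    apply: (eq_measurable_fun (fun z => fine (a z setT) `^ (-1))).
      by move=> z _; rewrite powR_inv1// fine_ge0.
    apply: (measurableT_comp (measurable_powR _)).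
    by apply: measurableT_comp; [exact: fine_measurable|exact: ma].
  have := emeasurable_funD (mm _ mdiag) (emeasurable_funM mk (measurable_product_measure ma mb a1 b1 mC)).
  by apply: eq_measurable_fun => z _ /=; rewrite rhoE.
- move=> z B mB; rewrite rhoE; last exact: measurableX.
  rewrite [X in (_ * X)%E]product_measure1E//.
  rewrite -[X in (_ * (_ * X))%E]/(b z setT) -[X in (_ * (X * _))%E]/(a z B) -abT.
  rewrite normK; last by rewrite measure_ge0 le_measure ?inE.
  rewrite sE//; congr (m z _ + _)%E; apply/seteqP; split=> x //=; tauto.
- move=> z B mB; rewrite rhoE; last exact: measurableX.
  rewrite [X in (_ * X)%E]product_measure1E//.
  rewrite -[X in (_ * (_ * X))%E]/(b z B) -[X in (_ * (X * _))%E]/(a z setT) [(a z setT * _)%E]muleC.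
  rewrite normK; last by rewrite abT measure_ge0 le_measure ?inE.
  rewrite tE//; congr (m z _ + _)%E; apply/seteqP; split=> x //=; tauto.
(* The diagonal part never disagrees and the product part has total mass [a z setT], that is s(P) -
   t(P), one of the differences in the supremum defining [tv_dist]. *)
- move=> z; rewrite rhoE//.
  rewrite (_ : [set x | _] = set0) ?measure0 ?add0e; last first.
    by apply/seteqP; split=> x //=; rewrite eqxx.
  apply: (@le_trans _ _ (((fine (a z setT))^-1)%:E * (a z \x b z) (setT `*` setT))%E).
    apply: lee_wpmul2l; first by rewrite lee_fin invr_ge0 fine_ge0.
    by apply: le_measure; rewrite ?inE//; exact: measurableX.
  rewrite product_measure1E//.
  rewrite -[X in (_ * (_ * X))%E]/(b z setT) -[X in (_ * (X * _))%E]/(a z setT) -abT.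
  rewrite normK ?lexx ?measure_ge0//.
  rewrite aE// setTI; apply: le_trans (lee_abs _) _.
  by apply: ereal_sup_ubound; exists (P z).
Qed.

(** * Colour-by-colour sweeps *)

Require Import Defs.
From HB Require Import structures.
From mathcomp Require Import all_boot all_order all_algebra.
From mathcomp Require Import all_classical all_reals all_analysis.
From mathcomp Require Import measurable_realfun.
From mathcomp Require Import ring lra zify.
Set Implicit Arguments.
Unset Strict Implicit.
Unset Printing Implicit Defensive.
Import Order.TTheory GRing.Theory Num.Theory.
Import numFieldNormedType.Exports.
Local Open Scope classical_set_scope.
Local Open Scope ring_scope.

Section Sweeps.
Context (R : realType) (L : eqType) (T : Type).
Variables (u : T -> L -> R) (w : T -> bool -> L -> L -> R).
Variables (N : L -> seq L) (col : L -> nat) (chi : nat).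
Variables (kappa c : L -> L -> R) (D K kb cb lam r : R).

(** The numerical trace of redrawing the spins at [l]; [i] tells which copy is weighed by [h]. Other
    sites are frozen. A disagreement at [l] costs [kappa] if [h] is at most [K] around [l] in both
    copies, and otherwise is paid for by a large [h] divided by [K]. The redrawn spins can disagree
    only if some neighbours do, and [h] of a redrawn spin obeys the moment inequality with matrix
    [c]. The last clause combines both effects. *)
Definition one_site_step (l : L) (x x' : T) : Prop :=
  [/\ (forall a, a != l -> u x' a <= u x a) /\
      (forall i a b, a != l -> b != l -> w x' i a b <= w x i a b),
      u x' l <= \sum_(a <- N l) kappa l a * u x a +
        K^-1 * \sum_(i <- [:: false; true])
                 \sum_(a <- N l) \sum_(b <- N l) w x i a b,
      forall i b, b != l -> w x' i l b <= \sum_(a <- N l) w x i a b,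
      forall i a, a != l ->
        w x' i a l <= u x a + \sum_(b <- N l) c l b * w x i a b &
      forall i, w x' i l l <=
        \sum_(a <- N l) (u x a + \sum_(b <- N l) c l b * w x i a b)].

Hypothesis step_ex : forall x l, exists x', one_site_step l x x'.

Hypothesis size_N : forall l, (size (N l))%:R <= D.
Hypothesis col_lt : forall l, (col l < chi)%N.
Hypothesis col_proper : forall l a, a \in N l -> col a != col l.
Hypothesis chi_ge2 : (2 <= chi)%N.
Hypothesis kappa_ge0 : forall l a, 0 <= kappa l a.
Hypothesis c_ge0 : forall l a, 0 <= c l a.
Hypothesis kappa_sum : forall l, \sum_(a <- N l) kappa l a <= kb.
Hypothesis c_sum : forall l, \sum_(a <- N l) c l a <= cb.
Hypothesis D_ge1 : 1 <= D.
Hypothesis K_gt0 : 0 < K.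
Hypothesis cb_ge0 : 0 <= cb.
Hypothesis lam_gt0 : 0 < lam.
Hypothesis r01 : 0 < r < 1.
Hypothesis lam_fix : D ^+ chi * (1 + cb * lam) <= r * lam.
Hypothesis kb_fix : kb + 2 * D ^+ 2 * K^-1 * (D ^+ (chi - 2) * lam) <= r.

Definition I_weight (S : pred L) a : R := if S a then D ^+ (col a).+1 else 1.
Definition H_weight (S : pred L) b : R := if S b then 1 + cb * lam else lam.

(* [S] is the set of sites already updated in the current sweep.  Redrawing the
   spin at [b] lowers [H_weight] at [b] below [lam], while each updated colour
   raises [I_weight] by a factor [D]; by [lam_fix] the net effect is [r]. *)
Definition sweep_bound (S : pred L) (s : R) (J : seq L) (x : T) : Prop :=
  (forall a, a \in J -> u x a <= s * (if S a then r else 1)) /\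
  (forall i a b, a \in J -> b \in J ->
     w x i a b <= s * (I_weight S a * H_weight S b)).

Let D_ge0 : 0 <= D. Proof. exact: le_trans D_ge1. Qed.
Let r_gt0 : 0 < r. Proof. by case/andP: r01. Qed.
Let r_lt1 : r < 1. Proof. by case/andP: r01. Qed.

Let z_gt0 : 0 < 1 + cb * lam.
Proof. by rewrite ltr_wpDr// mulr_ge0// ltW. Qed.

Let z_le_pow (n : nat) : (n <= chi)%N -> D ^+ n * (1 + cb * lam) <= lam.
Proof.
move=> nchi; apply: (@le_trans _ _ (D ^+ chi * (1 + cb * lam))).
  by rewrite ler_wpM2r ?(ltW z_gt0)// ler_weXn2l.
by apply: (le_trans lam_fix); rewrite ger_pMl// ltW.
Qed.

Let z_le_lam : 1 + cb * lam <= lam.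
Proof. by have := @z_le_pow 0%N isT; rewrite expr0 mul1r. Qed.

Let I_weight_ge1 S a : 1 <= I_weight S a.
Proof. by rewrite /I_weight; case: ifP => // _; exact: exprn_ege1. Qed.

Let H_weight_ge0 S b : 0 <= H_weight S b.
Proof. by rewrite /H_weight; case: ifP => _; exact: ltW. Qed.

Let H_weight_le S b : H_weight S b <= lam.
Proof. by rewrite /H_weight; case: ifP. Qed.

Let u_weight_le (S : pred L) a : (if S a then r else 1) <= 1 :> R.
Proof. by case: ifP => // _; exact: ltW. Qed.

Let sum_const (l : L) (f : L -> R) (M : R) : 0 <= M ->
  (forall a, a \in N l -> f a <= M) -> \sum_(a <- N l) f a <= D * M.
Proof.
move=> M0 fM; apply: (@le_trans _ _ (\sum_(a <- N l) M)).
  by rewrite big_seq [leRHS]big_seq; apply: ler_sum => a; exact: fM.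
by rewrite big_const_seq count_predT iter_addr_0 -mulr_natl ler_wpM2r.
Qed.

Let sum_wconst (k : L -> L -> R) (l : L) (f : L -> R) (M kk : R) :
  0 <= M -> (forall a b, 0 <= k a b) -> \sum_(a <- N l) k l a <= kk ->
  (forall a, a \in N l -> f a <= M) -> \sum_(a <- N l) k l a * f a <= kk * M.
Proof.
move=> M0 k0 kkk fM; apply: (@le_trans _ _ (\sum_(a <- N l) k l a * M)).
  by rewrite big_seq [leRHS]big_seq; apply: ler_sum => a aN; rewrite ler_wpM2l// fM.
by rewrite -mulr_suml ler_wpM2r.
Qed.

(** Around [l] exactly the lower colours are updated, so a neighbour has [I_weight] at most D^(col
    l), and summing over at most D neighbours yields the weight D^(col l + 1) of [l]. The inclusion
    of [N l] in [J] makes the old bounds available for every term read by the update. *)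
Lemma sweep_bound_step (S : pred L) s J x l : 0 <= s ->
  sweep_bound S s J x -> {subset N l <= J} ->
  (forall a, a \in N l -> S a = (col a < col l)%N) ->
  exists x', sweep_bound (predU1 l S) s J x'.
Proof.
move=> s0 [xu xw] NJ SN; have [x' [[u_n w_n] u_l w_lb w_al w_ll]] := step_ex x l.
have Il a : a \in N l -> I_weight S a <= D ^+ (col l).
  by move=> aN; rewrite /I_weight SN//; case: ifP => [al|_];
    [rewrite ler_weXn2l|rewrite exprn_ege1].
(* If [b] is updated, its [H_weight] 1 + cb * lam absorbs the power of D by [lam_fix]. If not, [b]
   has a colour above that of [l], so the colour of [l] is at most chi - 2; hence the exponent in
   [kb_fix]. *)
have WN a b : a \in N l -> b \in N l ->
    I_weight S a * H_weight S b <= D ^+ (chi - 2) * lam.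
  move=> aN bN; rewrite /H_weight SN//; case: ifPn => [_|bl].
    apply: (@le_trans _ _ lam); last by rewrite ler_peMl ?exprn_ege1// ltW.
    apply: le_trans (z_le_pow (ltnW (col_lt l))).
    by rewrite ler_wpM2r ?(ltW z_gt0)// Il.
  rewrite ler_wpM2r ?(ltW lam_gt0)//; apply: le_trans (Il a aN) _.
  have lb : (col l < col b)%N by rewrite ltn_neqAle eq_sym col_proper// leqNgt.
  by rewrite ler_weXn2l// leq_subRL// add2n; apply: leq_trans (col_lt b).
have uN a : a \in N l -> u x a <= s.
  by move=> aN; apply: le_trans (xu _ (NJ _ aN)) _; rewrite ler_piMr.
have W0 a b : 0 <= s * (I_weight S a * H_weight S b).
  by rewrite !mulr_ge0// (le_trans ler01).
have cW i a : a \in J ->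
    \sum_(b <- N l) c l b * w x i a b <= cb * (s * (I_weight S a * lam)).
  move=> aJ; apply: (@sum_wconst c) => //.
    by rewrite !mulr_ge0 ?(ltW lam_gt0)// (le_trans ler01).
  move=> b bN; apply: le_trans (xw i a b aJ (NJ _ bN)) _.
  by rewrite ler_wpM2l// ler_wpM2l// (le_trans ler01).
(* Since [I_weight] is at least 1, the term [u x a] is absorbed by the 1 in 1 + cb * lam. *)
have ucW i a : a \in J -> u x a <= s ->
    u x a + \sum_(b <- N l) c l b * w x i a b <=
    s * (I_weight S a * (1 + cb * lam)).
  move=> aJ ua; apply: le_trans (lerD ua (cW i a aJ)) _.
  have : s <= s * I_weight S a by rewrite ler_peMr.
  nra.
have H_l : H_weight (predU1 l S) l = 1 + cb * lam by rewrite /H_weight /= eqxx.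
have I_l : I_weight (predU1 l S) l = D ^+ (col l).+1 by rewrite /I_weight /= eqxx.
have H_n b : b != l -> H_weight (predU1 l S) b = H_weight S b.
  by move=> /negPf bl; rewrite /H_weight /= bl.
have I_n b : b != l -> I_weight (predU1 l S) b = I_weight S b.
  by move=> /negPf bl; rewrite /I_weight /= bl.
exists x'; split=> [a aJ|i a b aJ bJ].
  have [->|al] := eqVneq a l.
    2: by rewrite /= (negPf al); exact: le_trans (u_n a al) (xu _ aJ).
  rewrite /= eqxx; apply: (le_trans u_l).
  apply: (@le_trans _ _ (s * (kb + 2 * D ^+ 2 * K^-1 * (D ^+ (chi - 2) * lam)))); last first.
    by rewrite ler_wpM2l.
  rewrite mulrDr; apply: lerD.
    by rewrite [leRHS]mulrC; apply: (@sum_wconst kappa).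
  rewrite [leRHS](_ : _ = K^-1 * (D * (D * (s * (D ^+ (chi - 2) * lam))) +
    D * (D * (s * (D ^+ (chi - 2) * lam))))); last by ring.
  rewrite ler_wpM2l ?invr_ge0 ?(ltW K_gt0)// !big_cons big_nil addr0.
  have M0 : 0 <= s * (D ^+ (chi - 2) * lam).
    by apply: mulr_ge0 => //; apply: mulr_ge0; [exact: exprn_ge0|exact: ltW].
  by apply: lerD; apply: sum_const; [exact: mulr_ge0| |exact: mulr_ge0|] => a' a'N;
    apply: sum_const => // b' b'N; apply: le_trans (xw _ _ _ (NJ _ a'N) (NJ _ b'N)) _;
    rewrite ler_wpM2l// WN.
have [->|al] := eqVneq a l; have [->|bl] := eqVneq b l.
- rewrite I_l H_l; apply: (le_trans (w_ll i)).
  rewrite [leRHS](_ : _ = D * (s * (D ^+ col l * (1 + cb * lam)))); last by rewrite exprS; ring.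
  apply: sum_const; first by rewrite !mulr_ge0 ?exprn_ge0// ltW.
  move=> a' a'N; apply: le_trans (ucW i a' (NJ _ a'N) (uN _ a'N)) _.
  by rewrite ler_wpM2l// ler_wpM2r ?Il//; exact: ltW.
- rewrite I_l H_n//; apply: (le_trans (w_lb i b bl)).
  rewrite [leRHS](_ : _ = D * (s * (D ^+ col l * H_weight S b))); last by rewrite exprS; ring.
  apply: sum_const; first by rewrite !mulr_ge0 ?exprn_ge0.
  move=> a' a'N; apply: le_trans (xw i a' b (NJ _ a'N) bJ) _.
  by rewrite ler_wpM2l// ler_wpM2r ?Il.
- rewrite I_n// H_l; apply: (le_trans (w_al i a al)); apply: ucW => //.
  by apply: le_trans (xu _ aJ) _; rewrite ler_piMr.
- by rewrite I_n// H_n//; apply: le_trans (w_n i a b al bl) (xw i _ _ aJ bJ).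
Qed.

Lemma eq_sweep_bound (S S' : pred L) s J x : {in J, S =1 S'} ->
  sweep_bound S s J x -> sweep_bound S' s J x.
Proof.
move=> SS' [xu xw]; split=> [a aJ|i a b aJ bJ]; first by rewrite -SS'// xu.
by rewrite /I_weight /H_weight -!SS'//; exact: xw.
Qed.

Lemma sub_sweep_bound (S : pred L) s J J' x : {subset J <= J'} ->
  sweep_bound S s J' x -> sweep_bound S s J x.
Proof.
move=> JJ' [xu xw]; split=> [a aJ|i a b aJ bJ]; first by apply: xu; exact: JJ'.
by apply: xw; exact: JJ'.
Qed.

Definition colour_below (t : nat) : pred L := fun a => (col a < t)%N.

(** Sites of one colour are not adjacent, so updating one of them does not change which neighbours
    of another are updated. The bound for colours below [t] is called on [J] enlarged by its
    neighbours, which contains all that the updates read. *)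
Lemma sweep_bound_colour t s : 0 <= s ->
  (forall J, exists x, sweep_bound (colour_below t) s J x) ->
  forall J, exists x, sweep_bound (colour_below t.+1) s J x.
Proof.
move=> s0 IH J; pose J' := J ++ flatten [seq N l | l <- J].
have NJ' l : l \in J -> {subset N l <= J'}.
  move=> lJ a aN; rewrite mem_cat; apply/orP; right.
  by apply/flattenP; exists (N l) => //; exact: map_f.
suff [x xJ] : exists x,
    sweep_bound (fun a => (col a < t)%N || ((col a == t) && (a \in J))) s J' x.
  exists x; apply: (@eq_sweep_bound (fun a => (col a < t)%N || ((col a == t) && (a \in J)))).
    by move=> a aJ; rewrite /= aJ andbT /colour_below ltnS [RHS]leq_eqVlt orbC.
  by apply: sub_sweep_bound xJ => a aJ; rewrite mem_cat aJ.
have : {subset J <= J} by [].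
(* Only the list of sites treated so far is generalised to [Q]; the ambient [J] and [J'] stay
   fixed. *)
elim: {1 3}J => [_|l Q IHQ QJ].
  have [x xJ] := IH J'; exists x; apply: eq_sweep_bound xJ => a _.
  by rewrite /= in_nil andbF orbF.
have [|x xJ] := IHQ; first by move=> a aQ; apply: QJ; rewrite inE aQ orbT.
(* A site of another colour, or one that occurs again later in the list, is left alone. *)
have [/andP[/eqP lt lQ]|skip] := boolP ((col l == t) && (l \notin Q)).
  have := @sweep_bound_step _ s J' x l s0 xJ.
  case=> [||x' x'J].
  - by apply: NJ'; apply: QJ; rewrite inE eqxx.
  - by move=> a /col_proper; rewrite lt => /negPf ->; rewrite orbF.
  exists x'; apply: eq_sweep_bound x'J => a _ /=.
  rewrite inE; have [->|] //= := eqVneq a l.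
  by rewrite lt eqxx orbT.
exists x; apply: eq_sweep_bound xJ => a _ /=.
rewrite inE; have [->|] //= := eqVneq a l.
by move: skip; rewrite negb_and negbK; case: eqP => //= _ ->.
Qed.

(** After [chi] colours every site is updated and each weight is at most D^chi * (1 + cb * lam),
    hence at most r * lam by [lam_fix]. This is the bound for the empty set of updated sites with s
    * r in place of s, so the next sweep can start. *)
Lemma sweep_bound_contract s : 0 <= s ->
  (forall J, exists x, sweep_bound pred0 s J x) ->
  forall J, exists x, sweep_bound pred0 (s * r) J x.
Proof.
move=> s0 IH J.
have H t : forall J, exists x, sweep_bound (colour_below t) s J x.
  elim: t => [|t IHt]; last exact: sweep_bound_colour.
  by move=> J0; have [x xJ] := IH J0; exists x; exact: eq_sweep_bound xJ.
have [x [xu xw]] := H chi J; exists x; split=> [a aJ|i a b aJ bJ] /=.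
  by apply: le_trans (xu _ aJ) _; rewrite /colour_below col_lt mulr1.
apply: le_trans (xw i _ _ aJ bJ) _.
rewrite /I_weight /H_weight /colour_below !col_lt /= mul1r -mulrA ler_wpM2l//.
apply: le_trans lam_fix; rewrite ler_wpM2r ?(ltW z_gt0)// ler_weXn2l//.
Qed.

Lemma sweeps_vanish (x0 : T) (M : R) :
  (forall a, u x0 a <= M) -> (forall i a b, w x0 i a b <= M) ->
  forall (eps : R) (J : seq L), 0 < eps ->
  exists x, forall a, a \in J -> u x a <= eps.
Proof.
move=> uM wM eps J eps0.
(* The entry M / lam serves the initial bound on [w], which is compared with s * lam; the entry 1
   gives the nonnegativity of [s]. *)
pose s := Num.max 1 (Num.max M (M / lam)).
have s0 : 0 <= s by rewrite le_max ler01.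
have sM : M <= s by rewrite !le_max lexx orbT.
have sMl : M <= s * lam by rewrite -ler_pdivrMr// !le_max lexx !orbT.
have H n : forall J, exists x, sweep_bound pred0 (s * r ^+ n) J x.
  elim: n => [|n IHn].
    move=> J0; exists x0; split=> [a _|i a b _ _] /=.
      by rewrite expr0 !mulr1; exact: le_trans sM.
    by rewrite expr0 mulr1 /I_weight /H_weight /= mul1r; exact: le_trans sMl.
  rewrite exprSr mulrA; apply: sweep_bound_contract => //.
  by rewrite mulr_ge0// exprn_ge0// ltW.
have [n rn] : exists n, s * r ^+ n <= eps.
  have : (geometric s r) @ \oo --> (0 : R).
    by apply: cvg_geometric; rewrite gtr0_norm.
  move=> /cvgrPdist_le/(_ _ eps0)[n _ /(_ n (leqnn n))].
  rewrite sub0r normrN => h; exists n; apply: le_trans h.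
  by rewrite /geometric /=; exact: ler_norm.
have [x [xu _]] := H n J; exists x => a aJ.
by apply: le_trans (xu _ aJ) _; rewrite mulr1.
Qed.

End Sweeps.

(** * Updating a coupling at one site *)

Section ConfigurationMeasurability.
Context (L : countType) d (Xi : measurableType d).

Lemma measurable_coord (l : L) : measurable_fun setT (fun x : config L Xi => x l).
Proof.
move=> _ B mB; apply: sub_sigma_algebra; exists l => //.
by exists B.
Qed.

Lemma measurable_config dY (Y : measurableType dY) (f : Y -> config L Xi) :
  (forall l, measurable_fun setT (fun y => f y l)) -> measurable_fun setT f.
Proof.
move=> mf; apply: (@measurability _ _ Y (config L Xi) setT f (coord_sets setT)) => //.
by move=> _ [_ [l _ [B mB <-]] <-]; rewrite setTI; exact: mf.
Qed.

Lemma config_off_measurable (l : L) (A : set (L -> Xi)) :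
  measurable (A : set (config_off Xi l)) -> measurable (A : set (config L Xi)).
Proof.
move=> mA; apply: sub_sigma_algebra2 mA.
by move=> B [l' _ B'l]; exists l'.
Qed.

Lemma measurable_fun_config_off dY (Y : measurableType dY) (l : L)
    (f : (L -> Xi) -> Y) :
  measurable_fun setT (f : config_off Xi l -> Y) ->
  measurable_fun setT (f : config L Xi -> Y).
Proof. by move=> mf _ B mB; apply: config_off_measurable; exact: mf. Qed.

Lemma measurable_replace_at (l : L) :
  measurable_fun setT (fun q : config L Xi * Xi => replace_at l q.2 q.1).
Proof.
apply: measurable_config => l'; rewrite /replace_at.
have [_|_] := eqVneq l' l; first exact: measurable_snd.
exact: (measurableT_comp (measurable_coord l') measurable_fst).
Qed.

End ConfigurationMeasurability.

Lemma le_sum_seq_term (R : numDomainType) (I : eqType) (s : seq I) (F : I -> R) a :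
  a \in s -> (forall b, 0 <= F b) -> F a <= \sum_(b <- s) F b.
Proof. by move=> aS F0; rewrite (big_rem a)//= lerDl sumr_ge0. Qed.

Section HasIntegral.
Context d (T : measurableType d) (R : realType) (nu : probability T R).

(** The value [m] is real, so finiteness is part of the predicate and estimates can be carried out
    in [R]. *)
Definition has_integral (f : T -> R) (m : R) : Prop :=
  [/\ measurable_fun setT f, forall x, 0 <= f x & (\int[nu]_x (f x)%:E = m%:E)%E].

Lemma has_integralD (f g : T -> R) (m k : R) : has_integral f m -> has_integral g k ->
  has_integral (fun x => f x + g x) (m + k).
Proof.
move=> [mf f0 fm] [mg g0 gk]; split=> [|x|].
- exact: measurable_funD.
- by rewrite addr_ge0.
- under eq_integral do rewrite EFinD.
  rewrite ge0_integralD ?fm ?gk//.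
  all: by [move=> x _; rewrite lee_fin|exact/measurable_EFinP].
Qed.

Lemma has_integralZ (k : R) (f : T -> R) (m : R) : 0 <= k -> has_integral f m ->
  has_integral (fun x => k * f x) (k * m).
Proof.
move=> k0 [mf f0 fm]; split=> [|x|].
- exact: measurable_funM.
- by rewrite mulr_ge0.
- under eq_integral do rewrite EFinM.
  rewrite ge0_integralZl_EFin ?fm//; first by move=> x _; rewrite lee_fin.
  exact/measurable_EFinP.
Qed.

Lemma has_integral0 : has_integral (fun=> 0) 0.
Proof. by split=> //; rewrite integral0. Qed.

Lemma has_integral_sum (I : Type) (s : seq I) (f : I -> T -> R) (m : I -> R) :
  (forall i, has_integral (f i) (m i)) ->
  has_integral (fun x => \sum_(i <- s) f i x) (\sum_(i <- s) m i).
Proof.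
move=> fm; elim: s => [|i s IHs].
  rewrite big_nil (_ : (fun x => _) = (fun=> 0)); first exact: has_integral0.
  by apply/funext => x; rewrite big_nil.
rewrite big_cons (_ : (fun x => _) = (fun x => f i x + \sum_(j <- s) f j x)).
  exact: has_integralD.
by apply/funext => x; rewrite big_cons.
Qed.

Lemma has_integral_le (f g : T -> R) (m k : R) :
  has_integral f m -> has_integral g k -> (forall x, f x <= g x) -> m <= k.
Proof.
move=> [mf f0 fm] [mg g0 gk] fg; rewrite -lee_fin -fm -gk.
apply: ge0_le_integral => //; try exact/measurable_EFinP.
all: by move=> x _; rewrite lee_fin.
Qed.

Lemma has_integral_indic (A : set T) : measurable A ->
  has_integral \1_A (fine (nu A)).
Proof.
move=> mA; split=> //.
by rewrite integral_indic// setIT fineK// fin_num_measure.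
Qed.

Lemma has_integral_fine (f : T -> R) (M : R) : measurable_fun setT f -> (forall x, 0 <= f x) ->
  (\int[nu]_x (f x)%:E <= M%:E)%E ->
  has_integral f (fine (\int[nu]_x (f x)%:E)%E) /\
  fine (\int[nu]_x (f x)%:E)%E <= M.
Proof.
move=> mf f0 fM.
have int0 : (0 <= \int[nu]_x (f x)%:E)%E.
  by apply: integral_ge0 => x _; rewrite lee_fin.
have fin : (\int[nu]_x (f x)%:E)%E \is a fin_num.
  by rewrite ge0_fin_numE// (le_lt_trans fM)// ltry.
by split; [split; rewrite ?fineK|rewrite -lee_fin fineK].
Qed.

End HasIntegral.

(** * Comparison of the one-site laws of two configurations *)

Section OneSite.
Context (R : realType) (L : countType) (e : rel L) d (Xi : measurableType d).
Context (h : Xi -> R) (kappa c : L -> L -> R) (K : R).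
Context (pi : one_site_family (R := R) (L := L) (Xi := Xi)).
Hypothesis Hpi : in_Pi e h K kappa c pi.
Hypothesis h_ge0 : forall xi, 0 <= h xi.
Hypothesis kappa_ge0 : forall l a, 0 <= kappa l a.
Hypothesis K_gt0 : 0 < K.
Variable N : L -> seq L.
Hypothesis mem_N : forall l a, (a \in N l) = e l a.
Hypothesis sum_N : forall l (F : L -> R),
  \sum_(a \in nbr e l) F a = \sum_(a <- N l) F a.

Local Notation X := (config L Xi).

Lemma upsilon_ge0 (x y : Xi) : 0 <= upsilon x y :> R.
Proof. by rewrite /upsilon; case: ifP. Qed.

Lemma upsilon_le1 (x y : Xi) : upsilon x y <= 1 :> R.
Proof. by rewrite /upsilon; case: ifP. Qed.

Lemma tv_dist_ge0 (s t : probability Xi R) : (0 <= tv_dist s t)%E.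
Proof.
apply: le_trans (ereal_sup_ubound _); last by exists set0; first exact: measurable0.
exact: abse_ge0.
Qed.

Lemma tv_dist_le1 (s t : probability Xi R) : (tv_dist s t <= 1)%E.
Proof.
apply: ge_ereal_sup => _ [A mA <-].
have := probability_le1 s mA; have := probability_le1 t mA.
have : (0 <= s A)%E := measure_ge0 _ _; have : (0 <= t A)%E := measure_ge0 _ _.
rewrite -(fineK (fin_num_measure s _ mA)) -(fineK (fin_num_measure t _ mA)).
by rewrite -EFinB abse_EFin !lee_fin => *; rewrite ler_norml; lra.
Qed.

Lemma tv_dist_eq (s t : probability Xi R) :
  (forall B, measurable B -> s B = t B) -> tv_dist s t = 0%E.
Proof.
move=> st; apply/eqP; rewrite eq_le tv_dist_ge0 andbT.
apply: ge_ereal_sup => _ [A mA <-].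
by rewrite st// subee ?fin_num_measure// abse0.
Qed.

Lemma tv_dist_agree l (x y : X) : (forall a, a \in N l -> x a = y a) ->
  tv_dist (pi l x) (pi l y) = 0%E.
Proof.
move=> xy; have [[_ pi_nbr] _ _] := Hpi.
by apply: tv_dist_eq; apply: pi_nbr => a /= la; apply: xy; rewrite mem_N.
Qed.

Lemma agree_or_disagree (J : seq L) (x y : X) :
  (forall a, a \in J -> x a = y a) \/
  exists2 a, a \in J & upsilon (x a) (y a) = 1 :> R.
Proof.
have [/allP xy|/allPn[a aN xya]] := boolP (all (fun a => x a == y a) J).
  by left=> a /xy /eqP.
by right; exists a => //; rewrite /upsilon (negPf xya).
Qed.

Lemma tv_dist_le_disagree l (x y : X) :
  (tv_dist (pi l x) (pi l y) <= (\sum_(a <- N l) upsilon (x a) (y a))%:E)%E.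
Proof.
have [/tv_dist_agree ->|[a aN xya]] := agree_or_disagree (N l) x y.
  by rewrite lee_fin sumr_ge0// => a _; exact: upsilon_ge0.
apply: le_trans (tv_dist_le1 _ _) _; rewrite lee_fin -xya.
by apply: (le_sum_seq_term (F := fun a => upsilon (x a) (y a))) => // b; exact: upsilon_ge0.
Qed.

(** If the neighbours agree, the two laws coincide; if [h] is at most [K] at all neighbours in both
    configurations, the [kappa] bound applies. Otherwise some neighbour [a] disagrees and some
    neighbour [b] has [h] above [K] in copy [i]: the single term (i, a, b), divided by [K], already
    exceeds 1. *)
Lemma tv_dist_site_bound l (x y : X) :
  (tv_dist (pi l x) (pi l y) <=
   (\sum_(a <- N l) kappa l a * upsilon (x a) (y a) +
    K^-1 * \sum_(i <- [:: false; true]) \sum_(a <- N l) \sum_(b <- N l)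
      upsilon (x a) (y a) * h (if i then y b else x b))%:E)%E.
Proof.
have term_ge0 (i : bool) a b : 0 <= upsilon (x a) (y a) * h (if i then y b else x b).
  by rewrite mulr_ge0 ?upsilon_ge0.
have k_ge0 : 0 <= \sum_(a <- N l) kappa l a * upsilon (x a) (y a).
  by apply: sumr_ge0 => a _; rewrite mulr_ge0 ?upsilon_ge0.
have sum_ge0 : 0 <= K^-1 * \sum_(i <- [:: false; true]) \sum_(a <- N l)
    \sum_(b <- N l) upsilon (x a) (y a) * h (if i then y b else x b).
  by rewrite mulr_ge0 ?invr_ge0 ?(ltW K_gt0)// sumr_ge0// => i _; rewrite sumr_ge0// => a _; rewrite sumr_ge0.
have [/tv_dist_agree ->|[a aN xya]] := agree_or_disagree (N l) x y.
  by rewrite lee_fin addr_ge0.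
have [good|/existsNP[i /existsNP[b /not_implyP[bN /negP]]]] :=
    pselect (forall (i : bool) b, b \in N l -> h (if i then y b else x b) <= K).
  have [_ /(_ l x y) tvk _] := Hpi.
  apply: le_trans (tvk _ _) _ => [b|b|].
  - by move=> lb; apply: (good false); rewrite mem_N.
  - by move=> lb; apply: (good true); rewrite mem_N.
  - by rewrite sum_N lee_fin lerDl.
rewrite -ltNge => Kb; apply: le_trans (tv_dist_le1 _ _) _.
rewrite lee_fin -[leLHS]add0r lerD// -(mulVf (lt0r_neq0 K_gt0)).
rewrite ler_wpM2l ?invr_ge0 ?(ltW K_gt0)//.
apply: (@le_trans _ _ (upsilon (x a) (y a) * h (if i then y b else x b))).
  by rewrite xya mul1r ltW.
apply: le_trans (le_sum_seq_term (a := b)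
  (F := fun b => upsilon (x a) (y a) * h (if i then y b else x b)) bN _) _ => //.
apply: le_trans (le_sum_seq_term (a := a)
  (F := fun a => \sum_(b <- N l) upsilon (x a) (y a) * h (if i then y b else x b)) aN _) _.
  by move=> a'; rewrite sumr_ge0.
apply: (le_sum_seq_term (a := i) (F := fun i : bool => \sum_(a <- N l) \sum_(b <- N l)
    upsilon (x a) (y a) * h (if i then y b else x b))).
  by case: i {Kb}.
by move=> i'; rewrite sumr_ge0// => a' _; rewrite sumr_ge0.
Qed.

Lemma moment_bound l (x : X) :
  (\int[pi l x]_xi (h xi)%:E <= (1 + \sum_(b <- N l) c l b * h (x b))%:E)%E.
Proof. by have [_ _ /(_ l x)] := Hpi; rewrite sum_N. Qed.

End OneSite.

(** * The coupling after redrawing one site *)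

Section PairUpdate.
Context (R : realType) (L : countType) d (Xi : measurableType d).
Local Notation X := (config L Xi).

Definition copy (T : Type) (i : bool) (z : T * T) : T := if i then z.2 else z.1.

Definition pair_replace (l : L) (q : (X * X) * (Xi * Xi)) : X * X :=
  (replace_at l q.2.1 q.1.1, replace_at l q.2.2 q.1.2).

Lemma measurable_copy dT (T : measurableType dT) i :
  measurable_fun setT (@copy T i).
Proof. by case: i; [exact: measurable_snd|exact: measurable_fst]. Qed.

Lemma copy_pair_replace i l z w :
  copy i (pair_replace l (z, w)) = replace_at l (copy i w) (copy i z).
Proof. by case: i. Qed.

Lemma measurable_pair_replace l : measurable_fun setT (pair_replace l).
Proof.
apply/measurable_fun_pair; apply: measurable_config => l' /=; rewrite /replace_at.
  case: eqVneq => _; first exact: (measurableT_comp measurable_fst measurable_snd).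
  exact: (measurableT_comp (measurable_coord l')
    (measurableT_comp measurable_fst measurable_fst)).
case: eqVneq => _; first exact: (measurableT_comp measurable_snd measurable_snd).
exact: (measurableT_comp (measurable_coord l')
  (measurableT_comp measurable_snd measurable_fst)).
Qed.

Lemma disagree_pair_replace_ne a l z w : a != l ->
  disagree (R := R) a (pair_replace l (z, w)) = disagree a z.
Proof. by move=> /negPf al; rewrite /disagree /= /replace_at al. Qed.

Lemma disagree_pair_replace l z w :
  disagree (R := R) l (pair_replace l (z, w)) = upsilon w.1 w.2.
Proof. by rewrite /disagree /= /replace_at eqxx. Qed.

Lemma upsilon_indic (w : Xi * Xi) :
  upsilon w.1 w.2 = \1_[set w : Xi * Xi | w.1 != w.2] w :> R.
Proof.
rewrite /upsilon indicE; case: ifPn => [/eqP ww|ww].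
  by rewrite memNset//= ww eqxx.
by rewrite mem_set.
Qed.

Lemma copy_coupling (mu : bool -> probability X R) (nu : probability (X * X)%type R) :
  coupling (mu false) (mu true) nu <->
  forall i B, measurable B -> nu (@copy X i @^-1` B) = mu i B.
Proof.
split=> [cnu i B /cnu [n1 n2]|cnu B mB]; first by case: i.
by split; [exact: (cnu false)|exact: (cnu true)].
Qed.

Lemma integral_copy (mu : probability X R) (nu : probability (X * X)%type R) i
    (f : X -> \bar R) :
  (forall B, measurable B -> nu (@copy X i @^-1` B) = mu B) ->
  measurable_fun setT f -> (forall x, (0 <= f x)%E) ->
  (\int[nu]_z f (copy i z) = \int[mu]_x f x)%E.
Proof.
move=> cnu mf f0.
rewrite -(@ge0_integral_pushforward _ _ _ _ _ _ (@measurable_copy _ X i) nu setT f)//.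
apply: eq_measure_integral; first exact: measurable_copy.
by move=> mi B mB _; exact: cnu.
Qed.

End PairUpdate.

Section Update.
Context (R : realType) (L : countType) (e : rel L) d (Xi : measurableType d).
Context (A : nat -> set Xi).
Hypothesis hA : countable_separating_algebra A.
Context (pi : one_site_family (R := R) (L := L) (Xi := Xi)).
Hypothesis pi_spec : is_specification e pi.
Local Notation X := (config L Xi).
Variable mu : bool -> probability X R.
Hypothesis mu_consistent : forall i, consistent pi (mu i).

Let mpi l B : measurable B -> measurable_fun setT (fun x : X => pi l x B).
Proof.
have [mpi0 _] := pi_spec.
by move=> mB; apply: measurable_fun_config_off; exact: mpi0.
Qed.

Lemma measurable_pi_section l (B : set X) : measurable B ->
  measurable_fun setT (fun y : X => pi l y [set xi | B (replace_at l xi y)]).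
Proof.
move=> mB.
have [k kE] := @finite_kernel_of_family _ X _ _ R (fun x => pi l x) (@mpi l)
  (fun x => probability_le1 _ measurableT).
have mB' : measurable ((fun q : X * Xi => replace_at l q.2 q.1) @^-1` B).
  by rewrite -[_ @^-1` _]setTI; exact: measurable_replace_at.
have := measurable_fun_xsection_finite_kernel k (mem_set mB').
apply: eq_measurable_fun => y _; rewrite kE; congr (pi l y _).
by apply/seteqP; split=> xi; rewrite /xsection /= inE.
Qed.

Lemma consistent_section i l (B : set X) : measurable B ->
  (\int[mu i]_y pi l y [set xi | B (replace_at l xi y)] = mu i B)%E.
Proof.
move=> mB; rewrite (mu_consistent i l mB); apply: eq_integral => y _.
have mBy : measurable [set xi | B (replace_at l xi y)].
  have := measurableT_comp (@measurable_replace_at L _ Xi l) (measurable_pair1 y).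
  by move=> /(_ measurableT B mB); rewrite setTI.
by rewrite -(setIT [set xi | _]) -integral_indic.
Qed.

(** Marginals survive because [rho] has the one-site laws as marginals and each [mu i] is
    consistent. The last clause reduces a comparison of the new coupling with the old one to an
    inequality for each fixed pair of configurations; every clause of [one_site_step] is derived in
    this way. *)
Lemma one_site_update l (nu : probability (X * X)%type R) :
  coupling (mu false) (mu true) nu ->
  exists (nu' : probability (X * X)%type R)
         (rho : X * X -> probability (Xi * Xi)%type R),
  [/\ coupling (mu false) (mu true) nu',
      forall i z B, measurable B ->
        rho z (@copy Xi i @^-1` B) = pi l (copy i z) B,
      forall z, (rho z [set w | w.1 != w.2] <=
        tv_dist (pi l z.1) (pi l z.2))%E &
      forall f g m m', has_integral nu' f m -> has_integral nu g m' ->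
        (forall z, (\int[rho z]_w (f (pair_replace l (z, w)))%:E <= (g z)%:E)%E) ->
        m <= m'].
Proof.
move=> /copy_coupling cnu.
have [rho [mrho rho1 rho2 rho_neq]] := @measurable_optimal_coupling _ (X * X)%type
  _ Xi R A (fun z => pi l z.1) (fun z => pi l z.2) hA
  (fun B mB => measurableT_comp (mpi l mB) measurable_fst)
  (fun B mB => measurableT_comp (mpi l mB) measurable_snd).
have rho_copy i z B : measurable B -> rho z (@copy Xi i @^-1` B) = pi l (copy i z) B.
  move=> mB; case: i => /=.
    rewrite -rho2//; congr (rho z _); apply/seteqP; split=> w //=; by case.
  rewrite -rho1//; congr (rho z _); apply/seteqP; split=> w //=; by case.
have [nu' nu'E] := integral_kernel_pushforward nu mrho (measurable_pair_replace l).
exists nu', rho; split=> //.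
- apply/copy_coupling => i B mB.
  have mcB : measurable (@copy X i @^-1` B).
    by rewrite -[_ @^-1` _]setTI; exact: measurable_copy.
  have mI : measurable_fun setT (fun z => (\1_(@copy X i @^-1` B) z)%:E : \bar R).
    by apply/measurable_EFinP; exact: measurable_indic.
  rewrite -(setIT (_ @^-1` _)) -integral_indic//.
  have [|_ ->] := nu'E _ _ mI; first by move=> z; rewrite lee_fin.
  rewrite -(consistent_section i l mB).
  rewrite -(@integral_copy _ _ _ _ (mu i) nu i
    (fun y => pi l y [set xi | B (replace_at l xi y)]))//.
  + apply: eq_integral => z _.
    have mS : measurable [set xi | B (replace_at l xi (copy i z))].
      have := measurableT_comp (@measurable_replace_at L _ Xi l) (measurable_pair1 (copy i z)).
      by move=> /(_ measurableT B mB); rewrite setTI.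
    rewrite -rho_copy// -(setIT (_ @^-1` [set xi | _])) -integral_indic//.
      apply: eq_integral => w _; rewrite !indicE.
      suff -> : (pair_replace l (z, w) \in @copy X i @^-1` B) =
        (w \in @copy Xi i @^-1` [set xi | B (replace_at l xi (copy i z))]) by [].
      by apply/idP/idP; rewrite !inE /= copy_pair_replace.
    by rewrite -[_ @^-1` _]setTI; exact: measurable_copy.
  + exact: cnu.
  + exact: measurable_pi_section.
- move=> f g m m' [mf f0 fm] [mg g0 gm] fg.
  have [||mF nu'f] := nu'E (fun z => (f z)%:E).
  + by move=> z; rewrite lee_fin.
  + exact/measurable_EFinP.
  rewrite -lee_fin -fm -gm nu'f; apply: ge0_le_integral => //.
  + by move=> z _; apply: integral_ge0 => w _; rewrite lee_fin.
  + exact/measurable_EFinP.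
Qed.

End Update.

Section CouplingStep.
Context (R : realType) (L : countType) (e : rel L) d (Xi : measurableType d).
Context (A : nat -> set Xi).
Hypothesis hA : countable_separating_algebra A.
Context (h : Xi -> R) (kappa c : L -> L -> R) (K : R).
Context (pi : one_site_family (R := R) (L := L) (Xi := Xi)).
Hypothesis Hpi : in_Pi e h K kappa c pi.
Hypothesis e_irr : irreflexive e.
Hypothesis hmeas : measurable_fun setT h.
Hypothesis h_ge0 : forall xi, 0 <= h xi.
Hypothesis kappa_ge0 : forall l a, 0 <= kappa l a.
Hypothesis c_ge0 : forall l a, 0 <= c l a.
Hypothesis K_gt0 : 0 < K.
Variable N : L -> seq L.
Hypothesis mem_N : forall l a, (a \in N l) = e l a.
Hypothesis sum_N : forall l (F : L -> R),
  \sum_(a \in nbr e l) F a = \sum_(a <- N l) F a.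
Local Notation X := (config L Xi).
Variable mu : bool -> probability X R.
Hypothesis mu_consistent : forall i, consistent pi (mu i).
Variable M : R.
Hypothesis mu_moment : forall i a, (\int[mu i]_x (h (x a))%:E <= M%:E)%E.

Definition couplings : Type :=
  {nu : probability (X * X)%type R | coupling (mu false) (mu true) nu}.

Definition disagreement (x : couplings) (a : L) : R :=
  fine (\int[sval x]_z (disagree a z)%:E)%E.

(** [fine] would send an infinite integral to 0; [weighted_disagreementP] excludes this by means of
    the uniform moment bound [M]. *)
Definition weighted_disagreement (x : couplings) (i : bool) (a b : L) : R :=
  fine (\int[sval x]_z (disagree a z * h (copy i z b))%:E)%E.

Let measurable_h_copy i b : measurable_fun setT (fun z : X * X => h (copy i z b)).
Proof.
exact: (measurableT_comp hmeas (measurableT_comp (measurable_coord b)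
  (@measurable_copy _ X i))).
Qed.

Lemma measurable_upsilon : measurable_fun setT (fun w : Xi * Xi => upsilon w.1 w.2 : R).
Proof.
rewrite (_ : (fun w => _) = \1_[set w : Xi * Xi | w.1 != w.2]).
  by apply: measurable_indic; exact: measurable_neq hA.
by apply/funext => w; rewrite upsilon_indic.
Qed.

Lemma measurable_disagree a : measurable_fun setT (@disagree R L _ Xi a).
Proof.
apply: (measurableT_comp measurable_upsilon (g := fun z : X * X => (z.1 a, z.2 a))).
by apply/measurable_fun_pair => /=;
  [exact: (measurableT_comp (measurable_coord a) measurable_fst)|
   exact: (measurableT_comp (measurable_coord a) measurable_snd)].
Qed.

Let disagree_ge0 a (z : X * X) : 0 <= disagree a z :> R.
Proof. exact: upsilon_ge0. Qed.

Lemma disagreementP x a :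
  has_integral (sval x) (disagree a) (disagreement x a) /\ disagreement x a <= 1.
Proof.
apply: has_integral_fine => //; first exact: measurable_disagree.
rewrite -(@probability_setT _ _ _ (sval x)) -[leRHS]mul1e -integral_cst//.
apply: ge0_le_integral => //.
- by move=> z _; rewrite lee_fin.
- by apply/measurable_EFinP; exact: measurable_disagree.
- by move=> z _; rewrite lee_fin; exact: upsilon_le1.
Qed.

Lemma weighted_disagreementP x i a b :
  has_integral (sval x) (fun z => disagree a z * h (copy i z b))
    (weighted_disagreement x i a b) /\ weighted_disagreement x i a b <= M.
Proof.
apply: has_integral_fine.
- by apply: measurable_funM; [exact: measurable_disagree|exact: measurable_h_copy].
- by move=> z; rewrite mulr_ge0.
have mhb : measurable_fun setT (fun x : X => (h (x b))%:E).
  by apply/measurable_EFinP; exact: (measurableT_comp hmeas (measurable_coord b)).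
apply: le_trans (mu_moment i b).
rewrite -(@integral_copy _ _ _ _ (mu i) (sval x) i (fun x => (h (x b))%:E))//.
- apply: ge0_le_integral => //.
  + by move=> z _; rewrite lee_fin mulr_ge0.
  + apply/measurable_EFinP.
    by apply: measurable_funM; [exact: measurable_disagree|exact: measurable_h_copy].
  + by apply/measurable_EFinP; exact: measurable_h_copy.
  + by move=> z _; rewrite lee_fin ler_piMl//; exact: upsilon_le1.
- by case: x => nu /= /copy_coupling; apply.
- by move=> y; rewrite lee_fin.
Qed.

Let integral_const (nu : probability (Xi * Xi)%type R) (r : \bar R) :
  (\int[nu]__ r = r)%E.
Proof. by rewrite integral_cst// [X in (_ * X)%E]probability_setT mule1. Qed.

Lemma coupling_step x l :
  exists x', one_site_step disagreement weighted_disagreement N kappa c K l x x'.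
Proof.
have [pi_spec _ _] := Hpi; have mneq := measurable_neq hA.
have [nu' [rho [cnu' rho_copy rho_neq step]]] :=
  one_site_update hA pi_spec mu_consistent l (svalP x).
exists (exist _ nu' cnu'); set x' := exist _ _ _.
have HI y a := (disagreementP y a).1.
have HW y i a b := (weighted_disagreementP y i a b).1.
have lNl a : a \in N l -> a != l.
  by rewrite mem_N; apply: contraTneq => ->; rewrite e_irr.
have int_neq z : (\int[rho z]_w (upsilon w.1 w.2)%:E = rho z [set w | w.1 != w.2])%E.
  under eq_integral do rewrite upsilon_indic.
  by rewrite integral_indic// setIT.
have mups : measurable_fun setT (fun w : Xi * Xi => (upsilon w.1 w.2)%:E : \bar R).
  by apply/measurable_EFinP; exact: measurable_upsilon.
have mhc i : measurable_fun setT (fun w : Xi * Xi => (h (copy i w))%:E).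
  by apply/measurable_EFinP; exact: (measurableT_comp hmeas (@measurable_copy _ Xi i)).
have int_h i z : (\int[rho z]_w (h (copy i w))%:E = \int[pi l (copy i z)]_xi (h xi)%:E)%E.
  rewrite -(@ge0_integral_pushforward _ _ _ _ _ _ (@measurable_copy _ Xi i) (rho z) setT
    (fun xi => (h xi)%:E))//.
  - apply: eq_measure_integral; first exact: measurable_copy.
    by move=> mi B mB _; exact: rho_copy.
  - exact/measurable_EFinP.
  - by move=> xi _; rewrite lee_fin.
have rho_agree z : (rho z [set w | w.1 != w.2] <=
    (\sum_(a <- N l) disagree a z)%:E)%E.
  apply: le_trans (rho_neq z) _.
  exact: (tv_dist_le_disagree Hpi mem_N l z.1 z.2).
have moment i z : (\int[pi l (copy i z)]_xi (h xi)%:E <=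
    (1 + \sum_(b <- N l) c l b * h (copy i z b))%:E)%E.
  exact: (moment_bound Hpi sum_N l (copy i z)).
have sum_ge0 i z : 0 <= \sum_(b <- N l) c l b * h (copy i z b).
  by apply: sumr_ge0 => b _; rewrite mulr_ge0.
split; first split.
- move=> a al; apply: step (HI x' a) (HI x a) _ => z.
  under eq_integral do rewrite disagree_pair_replace_ne//.
  by rewrite integral_const.
- move=> i a b al bl; apply: step (HW x' i a b) (HW x i a b) _ => z.
  under eq_integral do
    rewrite disagree_pair_replace_ne// copy_pair_replace /replace_at (negPf bl).
  by rewrite integral_const.
- apply: (step _ (fun z => \sum_(a <- N l) kappa l a * disagree a z +
      K^-1 * \sum_(i <- [:: false; true]) \sum_(a <- N l) \sum_(b <- N l)
        disagree a z * h (copy i z b)) _ _ (HI x' l)).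
    apply: has_integralD.
      by apply: has_integral_sum => a; exact: has_integralZ.
    apply: has_integralZ; first by rewrite invr_ge0 ltW.
    by do 3 (apply: has_integral_sum => ?); exact: HW.
  move=> z; under eq_integral do rewrite disagree_pair_replace.
  rewrite int_neq; apply: le_trans (rho_neq z) _.
  apply: le_trans (tv_dist_site_bound Hpi h_ge0 kappa_ge0 K_gt0 mem_N sum_N l z.1 z.2) _.
  by rewrite lee_fin !big_cons !big_nil.
(* The spin at [b] is frozen, so its [h] factors out and the [rho z]-probability of disagreement
   remains. *)
- move=> i b bl; apply: (step _ (fun z => \sum_(a <- N l) disagree a z * h (copy i z b))
      _ _ (HW x' i l b)).
    by apply: has_integral_sum => a; exact: HW.
  move=> z; under eq_integral do
    rewrite disagree_pair_replace copy_pair_replace /replace_at (negPf bl) mulrC EFinM.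
  rewrite ge0_integralZl_EFin//; last by move=> w _; rewrite lee_fin upsilon_ge0.
  by rewrite int_neq -mulr_suml mulrC EFinM lee_wpmul2l// lee_fin.
(* Here the disagreement at [a] is frozen and factors out, leaving the moment of the redrawn
   spin. *)
- move=> i a al; apply: (step _ (fun z => disagree a z +
      \sum_(b <- N l) c l b * (disagree a z * h (copy i z b))) _ _ (HW x' i a l)).
    apply: has_integralD => //.
    by apply: has_integral_sum => b; exact: has_integralZ.
  move=> z; under eq_integral do
    rewrite disagree_pair_replace_ne// copy_pair_replace /replace_at eqxx EFinM.
  rewrite ge0_integralZl_EFin//; last by move=> w _; rewrite lee_fin.
  rewrite int_h (_ : _ + _ = disagree a z * (1 + \sum_(b <- N l) c l b * h (copy i z b))).
    by rewrite EFinM lee_wpmul2l// lee_fin.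
  by rewrite mulrDr mulr1 mulr_sumr; congr (_ + _); apply: eq_bigr => b _; rewrite mulrCA.
- move=> i; apply: (step _ (fun z => \sum_(a <- N l) (disagree a z +
      \sum_(b <- N l) c l b * (disagree a z * h (copy i z b)))) _ _ (HW x' i l l)).
    apply: has_integral_sum => a; apply: has_integralD => //.
    by apply: has_integral_sum => b; exact: has_integralZ.
  move=> z; under eq_integral do
    rewrite disagree_pair_replace copy_pair_replace /replace_at eqxx.
  have -> : \sum_(a <- N l) (disagree a z +
      \sum_(b <- N l) c l b * (disagree a z * h (copy i z b))) =
    (\sum_(a <- N l) disagree a z) * (1 + \sum_(b <- N l) c l b * h (copy i z b)).
    rewrite mulr_suml; apply: eq_bigr => a _.
    by rewrite mulrDr mulr1 mulr_sumr; congr (_ + _); apply: eq_bigr => b _; rewrite mulrCA.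
  have mprod : measurable_fun setT (fun w : Xi * Xi => (upsilon w.1 w.2 * h (copy i w))%:E).
    apply/measurable_EFinP; apply: measurable_funM; first exact: measurable_upsilon.
    exact: (measurableT_comp hmeas (@measurable_copy _ Xi i)).
  (* Disagreement and [h] at [l] are redrawn together and do not factor. If the neighbours agree,
     the integrand vanishes almost surely; otherwise the indicator is bounded by 1, and the sum of
     disagreements, at least 1, makes room for the moment bound. *)
  have [agree|[a aN za]] := agree_or_disagree R (N l) z.1 z.2.
    have rho0 : rho z [set w | w.1 != w.2] = 0%E.
      apply/eqP; rewrite eq_le measure_ge0 andbT (le_trans (rho_neq z))//.
      by rewrite (tv_dist_agree Hpi mem_N agree).
    rewrite (@ge0_negligible_integral _ _ _ _ _ [set w | w.1 != w.2])//.
    + rewrite integral0_eq.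
        rewrite lee_fin; apply: mulr_ge0; first exact: sumr_ge0.
        by rewrite addr_ge0 ?sum_ge0.
      by move=> w [_ /negP]; rewrite negbK => ww; rewrite /upsilon ww mul0r.
    + by move=> w _; rewrite lee_fin mulr_ge0 ?upsilon_ge0.
  apply: (@le_trans _ _ (\int[rho z]_w (h (copy i w))%:E)%E).
    apply: ge0_le_integral => //.
    + by move=> w _; rewrite lee_fin mulr_ge0 ?upsilon_ge0.
    + by move=> w _; rewrite lee_fin ler_piMl// upsilon_le1.
  rewrite int_h; apply: le_trans (moment i z) _; rewrite lee_fin ler_peMl ?addr_ge0 ?sum_ge0//.
  rewrite -za; apply: (le_sum_seq_term (F := fun a => disagree a z)) => //.
Qed.

End CouplingStep.

(** * Uniqueness *)

Section Cylinders.
Context (L : countType) d (Xi : measurableType d).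
Local Notation X := (config L Xi).

Definition cylinder (J : seq L) (F : L -> set Xi) : set X :=
  [set x | forall a, a \in J -> F a (x a)].

Definition cylinders : set (set X) :=
  [set B | exists J, exists2 F, (forall a, measurable (F a)) & B = cylinder J F].

Lemma measurable_cylinder J F : (forall a, measurable (F a)) ->
  measurable (cylinder J F).
Proof.
move=> mF; elim: J => [|a J IHJ].
  by rewrite (_ : cylinder _ _ = setT)//; apply/seteqP; split.
rewrite (_ : cylinder _ _ = (fun x : X => x a) @^-1` F a `&` cylinder J F).
  apply: measurableI => //; rewrite -[_ @^-1` _]setTI; exact: measurable_coord.
apply/seteqP; split=> [x xJ|x [xa xJ] b].
  by split=> [|b bJ]; apply: xJ; rewrite inE ?eqxx// bJ orbT.
by rewrite inE => /predU1P[->//|]; exact: xJ.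
Qed.

Lemma cylindersI : setI_closed cylinders.
Proof.
move=> _ _ [J [F mF ->]] [J' [F' mF' ->]].
(* Padding with the whole space outside each list lets the two constraints be imposed on the
   concatenation. *)
exists (J ++ J'), (fun a => (if a \in J then F a else setT) `&`
                           (if a \in J' then F' a else setT)).
  by move=> a; apply: measurableI; case: ifP.
apply/seteqP; split=> [x [xJ xJ'] a _|x xJJ'].
  by split; case: ifPn => // aJ; [exact: xJ|exact: xJ'].
split=> a aJ; have := xJJ' a; rewrite mem_cat aJ ?orbT => /(_ isT) [];
  by case: ifP.
Qed.

Lemma measurable_cylinders : @measurable _ X = <<s cylinders >>.
Proof.
apply/seteqP; split; apply: smallest_sub.
- exact: smallest_sigma_algebra.
- move=> _ [a _ [B mB <-]]; apply: sub_sigma_algebra.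
  exists [:: a], (fun=> B) => //; rewrite setTI.
  apply/seteqP; split=> [x xB b|x xB]; first by rewrite inE => /eqP ->.
  by apply: xB; rewrite inE.
- exact: sigma_algebra_measurable.
- by move=> _ [J [F mF ->]]; exact: measurable_cylinder.
Qed.

End Cylinders.

Section Uniqueness.
Context (R : realType) (L : countType) d (Xi : measurableType d).
Context (A : nat -> set Xi).
Hypothesis hA : countable_separating_algebra A.
Local Notation X := (config L Xi).
Variable mu : bool -> probability X R.

(** If copy [i] lies in the cylinder and the other copy does not, the two disagree at some site of
    [J]. *)
Lemma cylinder_le (x : couplings mu) i J F : (forall a, measurable (F a)) ->
  fine (mu i (cylinder J F)) <=
  fine (mu (~~ i) (cylinder J F)) + \sum_(a <- J) disagreement x a.
Proof.
move=> mF; have mC := measurable_cylinder J mF; have /copy_coupling cx := svalP x.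
have mcC j : measurable (@copy X j @^-1` cylinder J F).
  by rewrite -[_ @^-1` _]setTI; exact: measurable_copy.
rewrite -!cx//; apply: has_integral_le (has_integral_indic (sval x) (mcC i)) _ _.
  apply: has_integralD (has_integral_indic (sval x) (mcC (~~ i))) _.
  by apply: has_integral_sum => a; exact: (disagreementP hA x a).1.
move=> z; have s0 : 0 <= \sum_(a <- J) disagree a z :> R.
  by apply: sumr_ge0 => a _; exact: upsilon_ge0.
rewrite !indicE; have [zi|] := boolP (_ \in _); last by rewrite addr_ge0.
have [zni|zni] := boolP (_ \in _); first by rewrite lerDl.
have [zJ|[a aJ za]] := agree_or_disagree R J z.1 z.2.
  move/negP: zni; case; apply/mem_set => a aJ.
  have := set_mem zi a aJ; have := zJ a aJ.
  by case: (i); rewrite /= /copy => ->.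
rewrite add0r -za.
by apply: (le_sum_seq_term (F := fun a => disagree a z)) => // b; exact: upsilon_ge0.
Qed.

(** Cylinders form a generating pi-system and each involves finitely many sites, so the coupling may
    depend on [J] and [eps]. *)
Lemma vanishing_disagreement_eq :
  (forall (eps : R) (J : seq L), 0 < eps ->
     exists x : couplings mu, forall a, a \in J -> disagreement x a <= eps) ->
  forall B, measurable B -> mu false B = mu true B.
Proof.
move=> vanish B mB.
apply: (@measure_unique _ R X (@cylinders L _ Xi) (fun=> setT) _ _ _ _
  (mu false) (mu true)) => //.
- exact: measurable_cylinders.
- exact: cylindersI.
- move=> _; exists [::], (fun=> setT) => //.
  by apply/seteqP; split.
- by rewrite bigcup_const.
- move=> _ [J [F mF ->]].
  have mC := measurable_cylinder J mF.
  have le i : fine (mu i (cylinder J F)) <= fine (mu (~~ i) (cylinder J F)).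
    apply/ler_addgt0Pr => eps eps0.
    (* The successor avoids a division by 0 when [J] is empty. *)
    have epsJ : 0 < eps / (size J).+1%:R by rewrite divr_gt0.
    have [x xJ] := vanish _ J epsJ.
    apply: le_trans (cylinder_le x i J mF) _; rewrite lerD2l.
    apply: (@le_trans _ _ (\sum_(a <- J) eps / (size J).+1%:R)).
      by rewrite big_seq [leRHS]big_seq; apply: ler_sum => a; exact: xJ.
    rewrite big_const_seq count_predT iter_addr_0 -[_ *+ size J]mulr_natr -mulrA.
    rewrite ler_piMr ?(ltW eps0)//.
    by rewrite mulrC ler_pdivrMr// mul1r ler_nat.
  suff : mu false (cylinder J F) = mu true (cylinder J F) by [].
  rewrite -[LHS]fineK ?fin_num_measure// -[RHS]fineK ?fin_num_measure//.
  by congr EFin; apply/eqP; rewrite eq_le (le false) (le true).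
- by move=> _; rewrite [ltLHS]probability_setT ltry.
Qed.

End Uniqueness.

(** With E = D^chi, taking r = 1 - eta and lam = E / (r - cbar * E) turns the first inequality into
    an equality. The second becomes 2 * E^2 <= K * (r - kbar) * (r - cbar * E), which is where a
    large [K] is used. *)
Lemma sweep_constants (R : realType) (D : R) (chi : nat) (kbar cbar K : R) :
  1 <= D -> (2 <= chi)%N -> 0 <= kbar < 1 -> 0 < cbar -> cbar < 1 / D ^+ chi ->
  2 * D ^+ chi.+1 * (2 * D ^+ chi.-1 + 1 - cbar * D ^+ chi)
    / ((1 - kbar) ^+ 2 * (1 - cbar * D ^+ chi)) < K ->
  exists lam r, [/\ 0 < lam, 0 < r < 1,
    D ^+ chi * (1 + cbar * lam) <= r * lam &
    kbar + 2 * D ^+ 2 * K^-1 * (D ^+ (chi - 2) * lam) <= r].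
Proof.
move=> D1 chi2 /andP[k0 k1] c0 cD KK.
have D0 : 0 < D by exact: lt_le_trans D1.
pose E := D ^+ chi; have E0 : 0 < E by rewrite exprn_gt0.
pose p := 1 - kbar; pose q := 1 - cbar * E.
have p0 : 0 < p by rewrite subr_gt0.
have q0 : 0 < q by rewrite subr_gt0 -ltr_pdivlMr.
have p1 : p <= 1 by rewrite gerBl.
have cE0 : 0 < cbar * E by rewrite mulr_gt0.
(* This weakens the lower bound on [K]: the positive summand [q] in the numerator is dropped, and
   one factor [p], at most 1, is removed. *)
have K0E : 4 * E ^+ 2 < K * (p * q).
  have pq0 : 0 < p ^+ 2 * q by rewrite mulr_gt0// exprn_gt0.
  have E0' : 0 < D ^+ chi.-1 by rewrite exprn_gt0.
  have EE : D ^+ chi.+1 * D ^+ chi.-1 = E ^+ 2.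
    rewrite -exprD -exprM; congr (_ ^+ _).
    by case: chi chi2 {E E0 q q0 cE0 cD KK pq0 E0'} => //= n _; lia.
  have X0 : 0 < 2 * D ^+ chi.+1 * q by rewrite !mulr_gt0// exprn_gt0.
  move: KK; rewrite ltr_pdivrMr; last exact: pq0.
  rewrite -addrA -/q -/p mulrDr => KK.
  have Kpos : 0 <= K.
    rewrite leNgt; apply/negP => Kneg.
    have : K * (p ^+ 2 * q) < 0 by rewrite nmulr_rlt0.
    have : 0 < E ^+ 2 by rewrite exprn_gt0.
    by move: KK EE X0; nra.
  have : K * (p ^+ 2 * q) <= K * (p * q).
    by rewrite ler_wpM2l// ler_wpM2r ?(ltW q0)// expr2 ler_piMr// ltW.
  have -> : 4 * E ^+ 2 = 2 * D ^+ chi.+1 * (2 * D ^+ chi.-1) by rewrite -EE; ring.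
  by move: KK X0; lra.
have K0 : 0 < K.
  rewrite ltNge; apply/negP => Kneg.
  have : K * (p * q) <= 0 by rewrite mulr_le0_ge0// ltW// mulr_gt0.
  have : 0 < E ^+ 2 by rewrite exprn_gt0.
  by lra.
(* A quarter of the smaller gap keeps three quarters of both [p] and [q]. *)
pose eta := Num.min p q / 4.
have eta0 : 0 < eta by rewrite divr_gt0// lt_min p0.
have etap : 4 * eta <= p by rewrite /eta mulrC divfK// ge_min lexx.
have etaq : 4 * eta <= q by rewrite /eta mulrC divfK// ge_min lexx orbT.
have rE0 : 0 < 1 - eta - cbar * E by rewrite /q in etaq; lra.
exists (E / (1 - eta - cbar * E)), (1 - eta); split.
- by rewrite divr_gt0.
- by apply/andP; split; lra.
- rewrite -/E le_eqVlt; apply/orP; left; apply/eqP.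
  by field; rewrite gt_eqF.
- have -> : 2 * D ^+ 2 / K * (D ^+ (chi - 2) * (E / (1 - eta - cbar * E))) =
      2 * E ^+ 2 / (K * (1 - eta - cbar * E)).
    have -> : E ^+ 2 = D ^+ 2 * D ^+ (chi - 2) * E by rewrite -exprD subnKC// expr2.
    by field; rewrite !gt_eqF.
  rewrite -lerBrDl ler_pdivrMr ?mulr_gt0//.
  apply: (@le_trans _ _ (K * (p * q) / 2)); first by lra.
  rewrite [leRHS]mulrCA -[leLHS]mulrA ler_wpM2l ?(ltW K0)//.
  (* The product of the two fractions is 9/16, above the required 1/2. *)
  have : (3/4 * p) * (3/4 * q) <= (1 - eta - kbar) * (1 - eta - cbar * E).
    by apply: ler_pM; rewrite /p /q in p0 q0 etap etaq *; lra.
  have : 0 < p * q by rewrite mulr_gt0.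
  by lra.
Qed.

(** * Finite neighbourhoods, number of colours, diagonal coupling *)

Section GraphFacts.
Context (R : realType) (L : countType) (e : rel L) (Delta : nat).
Hypothesis HDelta : max_degree e R = (Delta%:R)%:E.

Lemma counting_nbr_le l : (counting (nbr e l) <= (Delta%:R)%:E :> \bar R)%E.
Proof. by rewrite -HDelta; apply: ereal_sup_ubound; exists l. Qed.

Lemma finite_nbr l : finite_set (nbr e l).
Proof.
have := counting_nbr_le l; rewrite /counting; case: ifPn => [/asboolP//|_].
by rewrite leye_eq.
Qed.

Definition nbr_seq l : seq L := finmap.enum_fset (fset_set (nbr e l)).

Lemma mem_nbr_seq l a : (a \in nbr_seq l) = e l a.
Proof.
rewrite /nbr_seq (in_fset_set (finite_nbr l)).
by apply/idP/idP; rewrite inE.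
Qed.

Lemma size_nbr_seq l : (size (nbr_seq l) <= Delta)%N.
Proof.
have := counting_nbr_le l; rewrite /counting; case: ifPn => [_|/asboolPn]; last first.
  by move/(_ (finite_nbr l)).
by rewrite lee_fin ler_nat.
Qed.

Lemma sum_nbr_seq l (F : L -> R) :
  \sum_(a \in nbr e l) F a = \sum_(a <- nbr_seq l) F a.
Proof. exact: fsbig_finite (finite_nbr l). Qed.

Lemma row_sum_le (m : L -> L -> R) mbar l :
  row_sup e m = mbar%:E -> \sum_(a <- nbr_seq l) m l a <= mbar.
Proof.
move=> mE; rewrite -lee_fin -mE -sum_nbr_seq.
by apply: ereal_sup_ubound; exists l.
Qed.

(** With at most one colour there is no edge, so [Delta] is 0 and then [chi] is 0; but colouring a
    vertex takes at least one colour. *)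
Lemma chromatic_ge2 chi : (exists l : L, True) -> colorable e chi ->
  (chi <= Delta)%N -> (2 <= chi)%N.
Proof.
move=> [l0 _] [col colP] chiD; rewrite ltnNge; apply/negP => chi1.
have chi0 : (0 < chi)%N by case: (col l0) => k; exact: leq_ltn_trans.
have noedge l l' : ~~ e l l'.
  apply/negP => /colP /eqP; apply; apply: val_inj => /=.
  have := ltn_ord (col l); have := ltn_ord (col l').
  move: chi1 chi0; case: (chi) (col l) (col l') => [|[|n]]//= x y.
  by case: x y => [[|?] ?] [[|?] ?].
have : (max_degree e R <= 0)%E.
  apply: ge_ereal_sup => _ [l _ <-].
  rewrite (_ : nbr e l = set0); first by rewrite /counting asboolT// fset_set0.
  by apply/seteqP; split=> a //= ; rewrite /nbr /= (negPf (noedge l a)).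
rewrite HDelta lee_fin lern0 => /eqP D0.
by move: chiD; rewrite D0 leqn0 => /eqP chi00; rewrite chi00 in chi0.
Qed.

End GraphFacts.

Lemma gamma_ge0 (R : realType) (L : countType) d (Xi : measurableType d)
    (nu : probability (config L Xi * config L Xi)%type R) :
  (exists l : L, True) -> (0 <= gamma nu)%E.
Proof.
move=> [l _]; apply: le_trans (ereal_sup_ubound _); last by exists l.
by apply: integral_ge0 => z _; rewrite lee_fin upsilon_ge0.
Qed.

Lemma lambda_ge0 (R : realType) (L : countType) d (Xi : measurableType d)
    (h : Xi -> R) (nu : probability (config L Xi * config L Xi)%type R) :
  (exists l : L, True) -> (forall xi, 0 <= h xi) -> (0 <= lambda h nu)%E.
Proof.
move=> [l _] h0; rewrite /lambda le_max; apply/orP; left.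
apply: le_trans (ereal_sup_ubound _); last by exists l => //; exists l.
by apply: integral_ge0 => z _; rewrite lee_fin mulr_ge0 ?upsilon_ge0.
Qed.

Lemma diagonal_probability d (T : measurableType d) (R : realType)
    (mu : probability T R) :
  exists nu : probability (T * T)%type R,
    (forall C, nu C = mu [set x | C (x, x)]) /\
    forall f : T * T -> \bar R, measurable_fun setT f -> (forall z, (0 <= f z)%E) ->
      (\int[nu]_z f z = \int[mu]_x f (x, x))%E.
Proof.
have mdiag : measurable_fun setT (fun x : T => (x, x)) by exact: measurable_fun_pair.
have [nu0 nu0E] : exists nu0 : {measure set (T * T) -> \bar R},
    forall C, nu0 C = mu [set x | C (x, x)].
  by unshelve eexists (pushforward mu (fun x : T => (x, x))).
have nu0T : nu0 setT = 1%E by rewrite nu0E -(@probability_setT _ _ _ mu).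
have [nu nuE] := probability_of_measure nu0T.
exists nu; split=> [C|f mf f0]; first by rewrite nuE.
rewrite -(@ge0_integral_pushforward _ _ _ _ _ _ mdiag mu setT f)//.
by apply: eq_measure_integral => // B mB _; rewrite [LHS]nuE; exact: nu0E.
Qed.

Lemma diagonal_coupling (R : realType) (L : countType) d (Xi : measurableType d)
    (A : nat -> set Xi) (h : Xi -> R) (mu1 mu2 : probability (config L Xi) R) :
  countable_separating_algebra A -> measurable_fun setT h -> (forall xi, 0 <= h xi) ->
  (forall B, measurable B -> mu1 B = mu2 B) ->
  exists nu : probability (config L Xi * config L Xi)%type R,
    [/\ coupling mu1 mu2 nu, (gamma nu <= 0)%E & (lambda h nu <= 0)%E].
Proof.
move=> hA hmeas h0 mu12.
have [nu [nuE nu_int]] := diagonal_probability mu1.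
have mdis a : measurable_fun setT (@disagree R L _ Xi a).
  exact: measurable_disagree hA a.
have dis0 a z : 0 <= @disagree R L _ Xi a z by exact: upsilon_ge0.
have dis_diag a (x : config L Xi) : disagree a (x, x) = 0 :> R.
  by rewrite /disagree /upsilon eqxx.
have int0 (g : config L Xi * config L Xi -> R) l : measurable_fun setT g ->
    (forall z, 0 <= g z) -> (\int[nu]_z (disagree l z * g z)%:E <= 0)%E.
  move=> mg g0; rewrite nu_int.
  - by rewrite integral0_eq// => x _; rewrite dis_diag mul0r.
  - by apply/measurable_EFinP; exact: measurable_funM.
  - by move=> z; rewrite lee_fin mulr_ge0.
have mh (i : bool) l : measurable_fun setT (fun z : config L Xi * config L Xi => h (copy i z l)).
  exact: (measurableT_comp hmeas (measurableT_comp (measurable_coord l)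
    (@measurable_copy _ (config L Xi) i))).
exists nu; split.
- by move=> B mB; split; rewrite nuE -?mu12.
- apply: ge_ereal_sup => _ [l _ <-].
  under eq_integral do rewrite -[disagree l _]mulr1.
  exact: (int0 (fun=> 1)).
- rewrite /lambda ge_max; apply/andP; split; apply: ge_ereal_sup => _ [l _ [l' _ <-]].
    exact: (int0 (fun z => h (copy false z l')) l (mh false l')).
  exact: (int0 (fun z => h (copy true z l')) l (mh true l')).
Qed.

Theorem lemma3p7 (R : realType) (L : countType) (e : rel L)
    (Delta chi : nat)
    (d : measure_display) (Xi : measurableType d)
    (h : Xi -> R) (kappa c : L -> L -> R) (kbar cbar : R)
    (Hsimple : simple_graph e) (Hconn : connected_graph e)
    (HDelta : max_degree e R = (Delta%:R)%:E)
    (Hchi : is_chromatic_number e chi) (HchiDelta : (chi <= Delta)%N)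
    (HXi : standard_borel R Xi)
    (hmeas : measurable_fun setT h) (h_ge0 : forall xi, 0 <= h xi)
    (kappa_ge0 : forall l l', 0 <= kappa l l')
    (Hkbar : row_sup e kappa = kbar%:E) (kbar_lt1 : kbar < 1)
    (c_ge0 : forall l l', 0 <= c l l')
    (Hcbar : row_sup e c = cbar%:E) (cbar_gt0 : 0 < cbar)
    (cbar_lt : cbar < 1 / Delta%:R ^+ chi)
    (K : R) (HK : K_star Delta chi kbar cbar < K)
    (pi : one_site_family (R := R) (L := L) (Xi := Xi))
    (Hpi : in_Pi e h K kappa c pi)
    (mu1 mu2 : probability (config L Xi) R)
    (Hmu1 : in_M pi h mu1) (Hmu2 : in_M pi h mu2)
    (nu0 : probability (config L Xi * config L Xi)%type R)
    (Hnu0 : coupling mu1 mu2 nu0) :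
  exists nu : probability (config L Xi * config L Xi)%type R,
    [/\ coupling mu1 mu2 nu,
        (gamma nu <= (kbar + A_const Delta chi kbar * K^-1)%:E * gamma nu0
                     + (2 * A_const Delta chi kbar * K^-1)%:E * lambda h nu0)%E &
        (lambda h nu <= (Delta%:R ^+ chi.-1)%:E * gamma nu0
                        + (cbar * Delta%:R ^+ chi)%:E * lambda h nu0)%E].
Proof.
have [A hA] := standard_borel_countable_algebra HXi.
have [[l0 _] _] := Hconn.
have Lne : exists l : L, True by exists l0.
have [[col colP] _] := Hchi.
have chi2 : (2 <= chi)%N.
  by apply: (chromatic_ge2 HDelta Lne) HchiDelta; exists col.
have D1 : 1 <= Delta%:R :> R.
  by rewrite ler1n (leq_trans _ HchiDelta)// (leq_trans _ chi2).
have kbar0 : 0 <= kbar.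
  by apply: le_trans (row_sum_le HDelta l0 Hkbar); exact: sumr_ge0.
(* The first entry of the maximum yields the positivity of [K], the second is the condition of
   [sweep_constants]. *)
move: (HK); rewrite /K_star gt_max => /andP[HK1 HK2].
have K0 : 0 < K.
  apply: le_lt_trans HK1; rewrite divr_ge0 ?mulr_ge0 ?exprn_ge0// ?ler0n//.
    exact: ltW.
  by rewrite subr_ge0 ltW.
have [lam [r [lam0 r01 lam_fix kb_fix]]] :=
  sweep_constants D1 chi2 (introT andP (conj kbar0 kbar_lt1)) cbar_gt0 cbar_lt HK2.
pose mu (i : bool) := if i then mu2 else mu1.
have mu_consistent i : consistent pi (mu i).
  by case: i; [case: Hmu2|case: Hmu1].
have moment (m : probability (config L Xi) R) : in_M pi h m -> exists M : R,
    forall a, (\int[m]_x (h (x a))%:E <= M%:E)%E.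
  move=> [_ mfin]; pose S := ereal_sup (range (fun l : L => \int[m]_x (h (x l))%:E)%E).
  have S0 : (0 <= S)%E.
    apply: le_trans (ereal_sup_ubound _); last by exists l0.
    by apply: integral_ge0 => x _; rewrite lee_fin.
  exists (fine S) => a; rewrite fineK ?ge0_fin_numE//.
  by apply: ereal_sup_ubound; exists a.
have [[M1 mM1] [M2 mM2]] := (moment _ Hmu1, moment _ Hmu2).
have mu_moment i a : (\int[mu i]_x (h (x a))%:E <= (Num.max M1 M2)%:E)%E.
  case: i; [apply: le_trans (mM2 a) _|apply: le_trans (mM1 a) _];
    by rewrite lee_fin le_max lexx ?orbT.
have mu12 : forall B, measurable B -> mu1 B = mu2 B.
  apply: (vanishing_disagreement_eq hA (mu := mu)) => eps J eps0.
  have step := coupling_step hA Hpi Hsimple.2 hmeas h_ge0 kappa_ge0 c_ge0 K0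
    (mem_nbr_seq HDelta) (sum_nbr_seq HDelta) mu_consistent mu_moment.
  (* Sweeps start from [nu0]: 1 bounds its disagreements, and the moments of [mu1] and [mu2] bound
     the weighted ones at all pairs of sites. *)
  apply: (@sweeps_vanish R L (couplings mu) _ _ (nbr_seq e) (fun l => col l) chi
    kappa c Delta%:R K kbar cbar lam r step _ _ _ _ _ _ _ _ _ _ _ _ _ _ _
    (exist _ nu0 Hnu0) (Num.max 1 (Num.max M1 M2))) => //.
  - by move=> l; rewrite ler_nat (size_nbr_seq HDelta).
  - by move=> l a; rewrite (mem_nbr_seq HDelta) eq_sym => /colP.
  - by move=> l; exact: (row_sum_le HDelta l Hkbar).
  - by move=> l; exact: (row_sum_le HDelta l Hcbar).
  - exact: ltW.
  - move=> a; apply: le_trans (disagreementP hA _ a).2 _.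
    by rewrite le_max lexx.
  - move=> i a b.
    apply: le_trans (weighted_disagreementP hA hmeas h_ge0 mu_moment _ i a b).2 _.
    by rewrite le_max lexx orbT.
have [nu [cnu gnu lnu]] := diagonal_coupling hA hmeas h_ge0 mu12.
have g0 := gamma_ge0 nu0 Lne; have l0' := lambda_ge0 nu0 Lne h_ge0.
have A0 : 0 <= A_const Delta chi kbar.
  by rewrite /A_const divr_ge0 ?subr_ge0 ?(ltW kbar_lt1)// mulr_ge0// exprn_ge0.
exists nu; split=> //.
- apply: (le_trans gnu); apply: adde_ge0; apply: mule_ge0 => //; rewrite lee_fin.
    by rewrite addr_ge0// divr_ge0// ltW.
  by apply: divr_ge0; [exact: mulr_ge0|exact: ltW].
- apply: (le_trans lnu); apply: adde_ge0; apply: mule_ge0 => //; rewrite lee_fin.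
  by apply: mulr_ge0; [exact: ltW|exact: exprn_ge0].
Qed.
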